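(* Let $\mathbf A,\mathbf B\in\mathbb R^{n\times n}$ be s.p.d. matrices with $\operatorname{rank}(\mathbf A)\ge\operatorname{rank}(\mathbf B)$, and let $t\in(0,1)$. The set of barycenters $\mathcal K_t(\mathbf A,\mathbf B)$ has the following properties: 1. $\boldsymbol\Gamma_t$ is an extreme point of $\mathcal K_t(\mathbf A,\mathbf B)$ if and only if it is a McCann interpolant at time $t$. 2. $\mathcal K_t(\mathbf A,\mathbf B)$ is the closed convex hull of the set of all McCann interpolants at time $t$. 3. For any barycenter $\boldsymbol\Gamma_t^{\mathbf N_{12}}\in\mathcal K_t(\mathbf A,\mathbf B)$, $$\boldsymbol\Gamma_t^{\mathbf N_{12}}/\mathbf A=t^2(\mathbf B/\mathbf A-\mathbf N_{12}^*\mathbf N_{12}),\qquad\operatorname{rank}(\boldsymbol\Gamma_t^{\mathbf N_{12}})=\operatorname{rank}(\mathbf A)+\operatorname{rank}(\boldsymbol\Gamma_t^{\mathbf N_{12}}/\mathbf A).$$ Consequently, for $\boldsymbol\Gamma_t\in\mathcal K_t(\mathbf A,\mathbf B)$ the following are equivalent: (a) $\boldsymbol\Gamma_t$ is a McCann interpolant at time $t$; (b) $\boldsymbol\Gamma_t/\mathbf A=\mathbf 0$; (c) $\operatorname{rank}(\boldsymbol\Gamma_t)=\operatorname{rank}(\mathbf A)$.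
   Context: s.p.d. means symmetric positive semidefinite, $^*$ is the transpose, $^\dagger$ the Moore–Penrose pseudoinverse, $\mathbf C^{\dagger/2}:=(\mathbf C^{1/2})^\dagger$. $\mathcal W_2^2(\mathbf A,\mathbf B)=\operatorname{tr}\mathbf A+\operatorname{tr}\mathbf B-2\operatorname{tr}(\mathbf A^{1/2}\mathbf B\mathbf A^{1/2})^{1/2}$. $\mathcal K_t(\mathbf A,\mathbf B)=\operatorname*{arg\,min}_{\mathbf C\succeq\mathbf 0}(1-t)\mathcal W_2^2(\mathbf A,\mathbf C)+t\mathcal W_2^2(\mathbf B,\mathbf C)$. An OT matrix from $\mathbf A$ to $\mathbf B$ is $\mathbf T\in\mathbb R^{n\times n}$ with $\mathbf T\mathbf A\mathbf T^*=\mathbf B$ and $\operatorname{tr}(\mathbf A\mathbf T)=\operatorname{tr}[(\mathbf A^{1/2}\mathbf B\mathbf A^{1/2})^{1/2}]$. A McCann interpolant at time $t$ is $[(1-t)\mathbf I+t\mathbf T]\mathbf A[(1-t)\mathbf I+t\mathbf T]^*$ for some OT matrix $\mathbf T$ from $\mathbf A$ to $\mathbf B$. Block notation with respect to $\mathcal H_1=\mathcal R(\mathbf A)$ (range), $\mathcal H_2=\mathcal N(\mathbf A)$ (null space): $\mathbf A_{11}=\mathbf A|_{\mathcal H_1}$ is invertible and $\mathbf B_{ij}:\mathcal H_j\to\mathcal H_i$. For s.p.d. $\mathbf B$, $\mathbf B/\mathbf A:=\mathbf B_{22}-\mathbf B_{21}\mathbf B_{11}^\dagger\mathbf B_{12}$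 on $\mathcal H_2$; $\boldsymbol\Gamma_t/\mathbf A$ is defined in the same way using the blocks of $\boldsymbol\Gamma_t$. Parametrization of barycenters: fix $\mathbf G_{11}:\mathcal H_1\to\mathcal H_1$ with $\mathbf G_{11}\mathbf G_{11}^*=\mathbf A_{11}$ and let $\mathbf G=\begin{pmatrix}\mathbf G_{11}&\mathbf 0\\\mathbf 0&\mathbf 0\end{pmatrix}$. The elements of $\mathcal K_t(\mathbf A,\mathbf B)$ are $\boldsymbol\Gamma_t^{\mathbf N_{12}}=\mathbf G_t\mathbf G_t^*$ with $\mathbf G_t=(1-t)\mathbf G+t\mathbf M$, $$\mathbf M=\begin{pmatrix}(\mathbf G_{11}^* )^{-1}(\mathbf G_{11}^*\mathbf B_{11}\mathbf G_{11})^{1/2}&\mathbf 0\\\mathbf B_{21}\mathbf G_{11}(\mathbf G_{11}^*\mathbf B_{11}\mathbf G_{11})^{\dagger/2}+\mathbf N_{12}^*&\mathbf M_{22}\end{pmatrix},$$ where $\mathbf N_{12}:\mathcal H_2\to\mathcal H_1$ satisfies $\mathcal R(\mathbf N_{12})\subset\mathcal N(\mathbf B_{11}^{1/2}\mathbf G_{11})$ and $\mathbf N_{12}^*\mathbf N_{12}\preceq\mathbf B/\mathbf A$, and $\mathbf M_{22}:\mathcal H_2\to\mathcal H_2$ satisfies $\mathbf M_{22}\mathbf M_{22}^*=\mathbf B/\mathbf A-\mathbf N_{12}^*\mathbf N_{12}$; $\boldsymbol\Gamma_t^{\mathbf N_{12}}$ does not depend on the choice of $\mathbf M_{22}$. 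*)

(* Defs.v *)
From mathcomp Require Import all_boot all_order all_algebra.
From mathcomp Require Import all_classical all_reals all_analysis.

Set Implicit Arguments.
Unset Strict Implicit.
Unset Printing Implicit Defensive.

Import Order.TTheory GRing.Theory Num.Theory.
Import numFieldNormedType.Exports.

Local Open Scope classical_set_scope.
Local Open Scope ring_scope.

Section Convexity.
Variable R : realType.

Definition extreme_point (E : lmodType R) (K : set E) (x : E) : Prop :=
  K x /\ forall (y z : E) (a : R), K y -> K z -> 0 < a < 1 ->
    x = (1 - a) *: y + a *: z -> y = x /\ z = x.

Definition closed_convex_hull (m n : nat) (S : set 'M[R]_(m, n)) :
    set 'M[R]_(m, n) :=
  smallest (fun K : set 'M[R]_(m, n) => closed K /\ convex_set K) S.

End Convexity.

Section Matrices.
Variable R : realType.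

Definition psdmx (n : nat) (A : 'M[R]_n) : Prop :=
  A^T = A /\ forall v : 'cV[R]_n, 0 <= (v^T *m A *m v) 0 0.

(* The s.p.d. square root; it exists and is unique when A is s.p.d., and the
   default value 0 is only used for other A. *)
Definition sqrtmx (n : nat) (A : 'M[R]_n) : 'M[R]_n :=
  xget 0 [set S : 'M[R]_n | psdmx S /\ S *m S = A].

(* The Moore-Penrose pseudoinverse, as the unique solution of the four Penrose
   equations. *)
Definition pinvmp (m n : nat) (A : 'M[R]_(m, n)) : 'M[R]_(n, m) :=
  xget 0 [set X : 'M[R]_(n, m) |
    [/\ A *m X *m A = A, X *m A *m X = X,
        (A *m X)^T = A *m X & (X *m A)^T = X *m A]].

End Matrices.

Section Barycenters.
Variables (R : realType) (n : nat).
Implicit Types A B C T X Gam : 'M[R]_n.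

Definition W2sq A B : R :=
  \tr A + \tr B - 2%:R * \tr (sqrtmx (sqrtmx A *m B *m sqrtmx A)).

Definition bary_obj (t : R) A B C : R :=
  (1 - t) * W2sq A C + t * W2sq B C.

Definition barycenters (t : R) A B : set 'M[R]_n :=
  [set C | psdmx C /\
    forall D : 'M[R]_n, psdmx D -> bary_obj t A B C <= bary_obj t A B D].

Definition OT_matrix A B T : Prop :=
  T *m A *m T^T = B /\
  \tr (A *m T) = \tr (sqrtmx (sqrtmx A *m B *m sqrtmx A)).

Definition mccann (t : R) A B : set 'M[R]_n :=
  [set Gam | exists2 T : 'M[R]_n, OT_matrix A B T &
    Gam = ((1 - t)%:M + t *: T) *m A *m ((1 - t)%:M + t *: T)^T].

(* The columns of U1 and of U2 are orthonormal bases of H1 = R(A) and of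
   H2 = N(A); matrices act on column vectors, whereas %MS compares row spaces,
   whence the transpositions. *)
Definition range_null_bases (r s : nat) A
    (U1 : 'M[R]_(n, r)) (U2 : 'M[R]_(n, s)) : Prop :=
  [/\ U1^T *m U1 = 1%:M, U2^T *m U2 = 1%:M,
      (U1^T :=: A^T)%MS & (U2^T :=: kermx A^T)%MS].

(* blk Ui Uj X is the matrix, in these bases, of the block X_ij : H_j -> H_i. *)
Definition blk (p q : nat) (U : 'M[R]_(n, p)) (V : 'M[R]_(n, q)) X :
    'M[R]_(p, q) :=
  U^T *m X *m V.

(* X / A, where A enters through the bases U1, U2 of its range and kernel. *)
Definition schur (r s : nat) (U1 : 'M[R]_(n, r)) (U2 : 'M[R]_(n, s)) X :
    'M[R]_s :=
  blk U2 U2 X - blk U2 U1 X *m pinvmp (blk U1 U1 X) *m blk U1 U2 X.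

Section Parametrization.
Variables (r s : nat) (U1 : 'M[R]_(n, r)) (U2 : 'M[R]_(n, s)).
Variables (t : R) (B : 'M[R]_n) (G11 : 'M[R]_r).
Variables (N12 : 'M[R]_(r, s)) (M22 : 'M[R]_s).

(* R(N12) is contained in N(B11^(1/2) G11), N12^* N12 <= B / A in the Loewner
   order, and M22 M22^* = B / A - N12^* N12. *)
Definition bary_param : Prop :=
  [/\ (N12^T <= kermx (sqrtmx (blk U1 U1 B) *m G11)^T)%MS,
      psdmx (schur U1 U2 B - N12^T *m N12) &
      M22 *m M22^T = schur U1 U2 B - N12^T *m N12].

Definition bary_G : 'M[R]_(r + s) := block_mx G11 0 0 0.

Definition bary_M : 'M[R]_(r + s) :=
  let S := sqrtmx (G11^T *m blk U1 U1 B *m G11) in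
  block_mx (invmx G11^T *m S)                             0
           (blk U2 U1 B *m G11 *m pinvmp S + N12^T)       M22.

Definition bary_Gt : 'M[R]_(r + s) := (1 - t) *: bary_G + t *: bary_M.

(* G_t G_t^*, transported from the coordinates of H1 + H2 back to R^n. *)
Definition bary_Gam : 'M[R]_n :=
  row_mx U1 U2 *m (bary_Gt *m bary_Gt^T) *m (row_mx U1 U2)^T.

End Parametrization.

End Barycenters.

(* Main.v *)
(** For factorizations A = G G^T and B = M M^T one has
    W_2^2(A, B) <= |G - M|^2, with equality iff tr (G M^T) is the maximal value
    tr (A^(1/2) B A^(1/2))^(1/2); given G, such an M exists.  With a common
    factor H of the third matrix, the identity
      (1 - t) |G - H|^2 + t |M - H|^2
        = t (1 - t) |G - M|^2 + |H - (1 - t) G - t M|^2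
    shows that the barycenters are the matrices H H^T, H = (1 - t) G + t M,
    with (G, M) optimal.  If G is n x r of full column rank r = rank A and
    S = (G^T B G)^(1/2), every optimal coupling G M^T equals G W^T for a unique
    n x r matrix W with G^T W = S and W W^T <= B, and the barycenter is an
    injective affine function of W; McCann interpolants are the W with
    W W^T = B.  Strict convexity of W |-> W W^T makes these W extreme.
    If D = B - W W^T is nonzero, pick w in the range of D with w w^T <= D and
    rank (D - w w^T) < rank D.  The columns of [W w] lie in the range of B,
    whose dimension is at most r, so W u = c w for some u <> 0 and some c;
    moving W along w u^T in both directions shows that W is a proper convex
    combination of two admissible matrices with gaps of smaller rank. *)

Require Import Defs.
From mathcomp Require Import all_boot all_order all_algebra.
From mathcomp Require Import all_classical all_reals all_analysis.
From mathcomp Require Import complex ring lra.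

Set Implicit Arguments.
Unset Strict Implicit.
Unset Printing Implicit Defensive.

Import Order.TTheory GRing.Theory Num.Theory.
Import numFieldNormedType.Exports.

Local Open Scope classical_set_scope.
Local Open Scope ring_scope.

(** * Spectral calculus for real symmetric matrices *)

(** Over [R[i]] the matrix is Hermitian, hence unitarily diagonalizable with real eigenvalues; the
    product over the distinct ones kills the diagonal form, and the embedding of [R] is
    injective. *)
Lemma symmx_split (R : realType) (n : nat) (A : 'M[R]_n.+1) :
  A^T = A -> exists2 s : seq R, uniq s &
    horner_mx A (\prod_(d <- s) ('X - d%:P)) = 0.
Proof.
move=> A_sym; pose f : {rmorphism R -> R[i]} := real_complex R.
pose Ac := map_mx f A.
have Ac_herm : Ac \is hermsymmx.
  apply/is_hermitianmxP; rewrite expr0 scale1r; apply/matrixP => i j.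
  by rewrite !mxE -{1}A_sym mxE; apply/esym; exact: conjc_real.
have D_real i : spectral_diag Ac 0 i \is Num.real.
  exact: (mxOverP (hermitian_spectral_diag_real Ac_herm)).
pose d i := complex.Re (spectral_diag Ac 0 i).
have dE i : (d i)%:C%C = spectral_diag Ac 0 i by apply/eqP; rewrite RRe_real.
exists (undup (codom d)); first exact: undup_uniq.
set q := \prod_(_ <- _) _; have q0 i : q.[d i] = 0.
  apply/rootP; rewrite root_prod_XsubC mem_undup; exact: codom_f.
apply: (map_mx_inj (f := f)); rewrite map_mx0 map_horner_mx.
move/hermitian_normalmx/orthomx_spectralP: Ac_herm; rewrite -/Ac => ->.
rewrite horner_mx_uconjC ?spectral_unit // horner_mx_diag.
suff -> : map_mx (horner (map_poly f q)) (spectral_diag Ac) = 0.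
  by rewrite (_ : diag_mx 0 = 0) ?mulmx0 ?mul0mx //; apply/matrixP=> i j;
     rewrite !mxE mul0rn.
apply/matrixP => i j; rewrite ord1 !mxE -dE.
by rewrite (horner_map f) q0 rmorph0.
Qed.

(** The minimal polynomial divides a product of distinct linear factors, so its roots are simple,
    and they are eigenvalues. Scalar identities on the spectrum thereby become matrix identities. *)
Lemma symmx_spectrum (R : realType) (n : nat) (A : 'M[R]_n.+1) :
  A^T = A -> exists s : seq R, [/\ uniq s, {in s, forall d, eigenvalue A d} &
    forall q : {poly R}, {in s, forall d, root q d} -> horner_mx A q = 0].
Proof.
move=> /symmx_split [s s_uniq sA]; have := mxminpoly_min sA.
case/dvdp_prod_XsubC => m; set s' := mask m s => minE.
have s'_uniq : uniq s' by exact: mask_uniq.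
exists s'; split=> // [d|q q0].
  by rewrite eigenvalue_root_min -root_prod_XsubC (eqp_root minE).
have : (mxminpoly A %| q)%R.
  by rewrite (eqp_dvdl _ minE) uniq_roots_dvdp ?uniq_rootsE //; apply/allP.
by case/dvdpP=> u ->; rewrite rmorphM /= mx_root_minpoly mulr0.
Qed.

Lemma interpolation (K : fieldType) (s : seq K) (f : K -> K) :
  uniq s -> exists p : {poly K}, {in s, forall d, p.[d] = f d}.
Proof.
elim: s => [|a s IHs] /=; first by exists 0.
case/andP=> a_s /IHs [p pE]; pose q := \prod_(d <- s) ('X - d%:P).
have q0 d : d \in s -> q.[d] = 0.
  by move=> ds; apply/rootP; rewrite root_prod_XsubC.
have qa : q.[a] != 0 by rewrite -rootE root_prod_XsubC.
exists (p + ((f a - p.[a]) / q.[a]) *: q) => d.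
rewrite inE !hornerE => /predU1P[->|ds]; first by rewrite divfK // addrC subrK.
by rewrite (q0 d ds) mulr0 addr0 pE.
Qed.

Lemma tr_horner_mx (K : comNzRingType) (n : nat) (A : 'M[K]_n.+1)
  (p : {poly K}) : (horner_mx A p)^T = horner_mx A^T p.
Proof.
elim/poly_ind: p => [|p c IHp]; first by rewrite !rmorph0 trmx0.
rewrite !rmorphD !rmorphM /= !horner_mx_X !horner_mx_C linearD /=.
rewrite tr_scalar_mx -[_ * A]/(_ *m A) trmx_mul IHp; congr (_ + _).
exact/comm_mx_horner.
Qed.

(** * Gram matrices and the existence of s.p.d. square roots *)

Lemma vdot_ge0 (R : realType) (n : nat) (v : 'cV[R]_n) : 0 <= (v^T *m v) 0 0.
Proof. by rewrite mxE sumr_ge0 // => i _; rewrite mxE -expr2 sqr_ge0. Qed.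

Lemma vdot_eq0 (R : realType) (n : nat) (v : 'cV[R]_n) :
  (v^T *m v) 0 0 = 0 -> v = 0.
Proof.
rewrite mxE => /eqP; rewrite psumr_eq0; last first.
  by move=> i _; rewrite mxE -expr2 sqr_ge0.
move=> /allP v0; apply/matrixP => i j; rewrite ord1 !mxE.
by have := v0 i (mem_index_enum i); rewrite /= mxE -expr2 sqrf_eq0 => /eqP.
Qed.

Lemma psd_gram (R : realType) (m n : nat) (G : 'M[R]_(m, n)) :
  psdmx (G *m G^T).
Proof.
split=> [|v]; first by rewrite trmx_mul trmxK.
by have := vdot_ge0 (G^T *m v); rewrite trmx_mul trmxK !mulmxA.
Qed.

Lemma psd_eigenvalue_ge0 (R : realType) (n : nat) (A : 'M[R]_n) (d : R) :
  psdmx A -> eigenvalue A d -> 0 <= d.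
Proof.
case=> A_sym A_ge0 /eigenvalueP [v vA v_neq0].
have := A_ge0 v^T; rewrite trmxK vA -scalemxAl mxE pmulr_lge0 // lt_neqAle.
have := vdot_ge0 v^T; rewrite trmxK => ->; rewrite andbT eq_sym.
apply: contra v_neq0 => /eqP; rewrite -{1}[v]trmxK => /vdot_eq0.
by move=> v0; rewrite -[v]trmxK v0 trmx0.
Qed.

Lemma sqrtmx_exists (R : realType) (n : nat) (A : 'M[R]_n) :
  psdmx A -> exists S : 'M[R]_n, psdmx S /\ S *m S = A.
Proof.
case: n A => [|n] A A_psd; first by exists A; rewrite !flatmx0; split=> //;
  rewrite -(flatmx0 A).
have [A_sym _] := A_psd; have [s [s_uniq s_eig s_ann]] := symmx_spectrum A_sym.
(* Interpolating the fourth root makes the square root [T *m T] a Gram matrix, so its positivity is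
   immediate. *)
have [p pE] := interpolation (fun d => Num.sqrt (Num.sqrt d)) s_uniq.
pose T := horner_mx A p; have T_sym : T^T = T by rewrite tr_horner_mx A_sym.
exists (T *m T); split; first by rewrite -{2}T_sym; exact: psd_gram.
apply/eqP; rewrite -subr_eq0; apply/eqP.
have := s_ann (p ^+ 4 - 'X); rewrite rmorphB rmorphXn /= horner_mx_X => <- //.
  by rewrite -/T [T ^+ 4](exprM T 2 2) !expr2.
move=> d ds; rewrite rootE !hornerE pE // (exprM _ 2 2) !sqr_sqrtr ?subrr //.
exact: psd_eigenvalue_ge0 A_psd (s_eig d ds).
Qed.

Lemma sqrtmxP (R : realType) (n : nat) (A : 'M[R]_n) :
  psdmx A -> psdmx (sqrtmx A) /\ sqrtmx A *m sqrtmx A = A.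
Proof.
move=> /sqrtmx_exists [S SE]; rewrite /sqrtmx.
by case: xgetP => [_ -> //|/(_ S)]; case.
Qed.

(** * The Moore-Penrose pseudoinverse *)

Definition penrose (R : realType) (m n : nat) (A : 'M[R]_(m, n)) X :=
  [/\ A *m X *m A = A, X *m A *m X = X,
      (A *m X)^T = A *m X & (X *m A)^T = X *m A].

Lemma penrose_unique (R : realType) (m n : nat) (A : 'M[R]_(m, n)) X Y :
  penrose A X -> penrose A Y -> X = Y.
Proof.
case=> X1 X2 X3 X4 [Y1 Y2 Y3 Y4].
have AXY : A *m X = A *m Y.
  by rewrite -X3 -{1}Y1 -mulmxA trmx_mul X3 Y3 mulmxA X1.
have XAY : X *m A = Y *m A.
  by rewrite -X4 -{1}Y1 -mulmxA mulmxA trmx_mul X4 Y4 -mulmxA (mulmxA A) X1.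
by rewrite -X2 -mulmxA AXY mulmxA XAY Y2.
Qed.

Lemma penrose_exists_sym (R : realType) (n : nat) (A : 'M[R]_n) :
  A^T = A -> exists X, penrose A X.
Proof.
case: n A => [|n] A A_sym.
  by exists A; split; rewrite !flatmx0 // trmx0.
have [s [s_uniq s_eig s_ann]] := symmx_spectrum A_sym.
(* [GRing.inv] sends 0 to 0, which is the right value on the null space. *)
have [p pE] := interpolation GRing.inv s_uniq.
pose X := horner_mx A p; exists X.
have X_sym : X^T = X by rewrite tr_horner_mx A_sym.
have AX : A *m X = X *m A by apply: comm_mx_horner.
have A1 : A *m X *m A = A.
  apply/eqP; rewrite -subr_eq0; apply/eqP; rewrite -(s_ann ('X * p * 'X - 'X)).
    by rewrite rmorphB !rmorphM /= horner_mx_X.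
  move=> d ds; rewrite rootE !hornerE pE //.
  by have [->|d0] := eqVneq d 0; rewrite ?mulr0 ?subrr // divff // mul1r subrr.
have A2 : X *m A *m X = X.
  apply/eqP; rewrite -subr_eq0; apply/eqP; rewrite -(s_ann (p * 'X * p - p)).
    by rewrite rmorphB !rmorphM /= horner_mx_X.
  move=> d ds; rewrite rootE !hornerE pE //.
  by have [->|d0] := eqVneq d 0; rewrite ?invr0 ?mulr0 ?subrr // mulVf // mul1r
    subrr.
by split=> //; rewrite trmx_mul A_sym X_sym AX.
Qed.

Lemma penrose_tr (R : realType) (m n : nat) (A : 'M[R]_(m, n)) X :
  penrose A X -> penrose A^T X^T.
Proof.
case=> X1 X2 X3 X4; split; rewrite -!trmx_mul ?trmxK ?mulmxA ?X1 ?X2 //.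
Qed.

Lemma penrose_sym (R : realType) (n : nat) (A X : 'M[R]_n) :
  A^T = A -> penrose A X -> X^T = X /\ A *m X = X *m A.
Proof.
move=> A_sym AX; have X_sym : X^T = X.
  by apply: (@penrose_unique _ _ _ A) => //; rewrite -{1}A_sym; exact: penrose_tr.
by split=> //; case: AX => _ _ <- _; rewrite trmx_mul A_sym X_sym.
Qed.

Lemma gram_tr_ge0 (R : realType) (m n : nat) (E : 'M[R]_(m, n)) :
  0 <= \tr (E *m E^T).
Proof.
apply: sumr_ge0 => i _; rewrite mxE sumr_ge0 // => j _.
by rewrite mxE -expr2 sqr_ge0.
Qed.

Lemma gram_tr_eq0 (R : realType) (m n : nat) (E : 'M[R]_(m, n)) :
  \tr (E *m E^T) = 0 -> E = 0.
Proof.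
move/eqP; rewrite psumr_eq0 => [|i _]; last first.
  by rewrite mxE sumr_ge0 // => j _; rewrite mxE -expr2 sqr_ge0.
move=> /allP E0; apply/matrixP => i j; rewrite mxE.
have := E0 i (mem_index_enum i); rewrite /= mxE psumr_eq0 => [|k _]; last first.
  by rewrite mxE -expr2 sqr_ge0.
by move/allP/(_ j (mem_index_enum j)); rewrite mxE -expr2 sqrf_eq0 => /eqP.
Qed.

Lemma gram_eq0 (R : realType) (m n : nat) (E : 'M[R]_(m, n)) :
  E *m E^T = 0 -> E = 0.
Proof. by move=> E0; apply: gram_tr_eq0; rewrite E0 mxtrace0. Qed.

Lemma gramT_eq0 (R : realType) (m n : nat) (E : 'M[R]_(m, n)) :
  E^T *m E = 0 -> E = 0.
Proof.
move=> E0; rewrite -[E]trmxK (@gram_eq0 _ _ _ E^T) ?trmxK ?E0 //.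
by rewrite trmx0.
Qed.

(** The formula [G^+ = (G^T G)^+ G^T] reduces to the symmetric case. *)
Lemma penrose_exists (R : realType) (m n : nat) (G : 'M[R]_(m, n)) :
  exists X, penrose G X.
Proof.
pose H := G^T *m G; have H_sym : H^T = H by rewrite trmx_mul trmxK.
have [X HX] := penrose_exists_sym H_sym; have [X_sym comm] := penrose_sym H_sym HX.
case: HX => X1 X2 _ X4; exists (X *m G^T).
have GXH : G *m (X *m H) = G.
  apply/eqP; rewrite -subr_eq0; apply/eqP/gramT_eq0.
  have HXH : H *m (X *m H) = H by rewrite mulmxA.
  rewrite -[X in X - _]/(G *m (X *m H)) -{2 4}[G]mulmx1 -mulmxBr trmx_mul.
  by rewrite -mulmxA (mulmxA G^T) -/H (mulmxBr H) mulmx1 HXH subrr mulmx0.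
split; rewrite ?mulmxA.
- by rewrite -!mulmxA.
- by rewrite -(mulmxA X) -/H X2.
- by rewrite !trmx_mul trmxK X_sym mulmxA.
- by rewrite -(mulmxA X) -/H X4.
Qed.

Lemma pinvmpP (R : realType) (m n : nat) (A : 'M[R]_(m, n)) :
  penrose A (pinvmp A).
Proof.
have [X AX] := penrose_exists A; rewrite /pinvmp.
by case: xgetP => [_ -> //|/(_ X)].
Qed.

(** * The positive semidefinite order, and couplings given by pairs of factors *)

Section Psd.
Variable R : realType.

Lemma psd0 (n : nat) : psdmx (0 : 'M[R]_n).
Proof. by split=> [|v]; rewrite ?trmx0 // mulmx0 mul0mx mxE. Qed.

Lemma psdD (n : nat) (A B : 'M[R]_n) : psdmx A -> psdmx B -> psdmx (A + B).
Proof.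
case=> A1 A2 [B1 B2]; split=> [|v]; first by rewrite linearD /= A1 B1.
by rewrite mulmxDr mulmxDl mxE addr_ge0.
Qed.

Lemma psdZ (n : nat) (a : R) (A : 'M[R]_n) :
  0 <= a -> psdmx A -> psdmx (a *: A).
Proof.
move=> a0 [A1 A2]; split=> [|v]; first by rewrite linearZ /= A1.
by rewrite -scalemxAr -scalemxAl mxE mulr_ge0.
Qed.

Lemma psd_conj (m n : nat) (X : 'M[R]_(m, n)) (A : 'M[R]_n) :
  psdmx A -> psdmx (X *m A *m X^T).
Proof.
case=> A1 A2; split=> [|v]; first by rewrite !trmx_mul trmxK A1 mulmxA.
by have := A2 (X^T *m v); rewrite trmx_mul trmxK !mulmxA.
Qed.

Lemma psd_conjT (m n : nat) (X : 'M[R]_(n, m)) (A : 'M[R]_n) :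
  psdmx A -> psdmx (X^T *m A *m X).
Proof. by move=> /(psd_conj X^T); rewrite trmxK. Qed.

Lemma psd_factor (n : nat) (A : 'M[R]_n) :
  psdmx A -> exists K : 'M[R]_n, A = K *m K^T.
Proof.
by move=> /sqrtmxP [[S_sym _] SS]; exists (sqrtmx A); rewrite S_sym SS.
Qed.

Lemma psd_tr_mul_ge0 (n : nat) (S Y : 'M[R]_n) :
  psdmx S -> psdmx Y -> 0 <= \tr (S *m Y).
Proof.
move=> /psd_factor [K ->] /psd_factor [L ->].
rewrite -mulmxA mxtrace_mulC.
by have := gram_tr_ge0 (K^T *m L); rewrite trmx_mul trmxK !mulmxA.
Qed.

Lemma psd_tr_ge0 (n : nat) (S : 'M[R]_n) : psdmx S -> 0 <= \tr S.
Proof. by move=> /psd_factor [K ->]; exact: gram_tr_ge0. Qed.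

Lemma psd_conj_tr_eq0 (m n : nat) (D : 'M[R]_n) (Z : 'M[R]_(n, m)) :
  psdmx D -> \tr (Z^T *m D *m Z) = 0 -> D *m Z = 0.
Proof.
move=> /psd_factor [K ->] tr0; rewrite -mulmxA.
suff -> : K^T *m Z = 0 by rewrite mulmx0.
suff E0 : (K^T *m Z)^T = 0 by rewrite -[_ *m _]trmxK E0 trmx0.
by apply: gram_tr_eq0; rewrite trmxK trmx_mul trmxK mulmxA -(mulmxA Z^T).
Qed.

Lemma psd_conj_eq0 (m n : nat) (D : 'M[R]_n) (Z : 'M[R]_(n, m)) :
  psdmx D -> Z^T *m D *m Z = 0 -> D *m Z = 0.
Proof. by move=> D_psd E; apply: psd_conj_tr_eq0 => //; rewrite E mxtrace0. Qed.

Lemma psd_neg_gram_eq0 (m n : nat) (X : 'M[R]_(m, n)) :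
  psdmx (- (X *m X^T)) -> X = 0.
Proof.
move=> /psd_tr_ge0; rewrite linearN /= oppr_ge0 => tr_le0.
by apply: gram_tr_eq0; apply/le_anti; rewrite tr_le0 gram_tr_ge0.
Qed.

Lemma psd_sub_proj (n : nat) (P : 'M[R]_n) :
  P^T = P -> P *m P = P -> psdmx (1%:M - P).
Proof.
move=> P1 P2; have -> : 1%:M - P = (1%:M - P) *m (1%:M - P)^T.
  rewrite linearB /= P1 trmx1 mulmxBl mul1mx mulmxBr mulmx1 P2 subrr subr0 //.
exact: psd_gram.
Qed.

(** Conjugating by [Q] leaves minus a Gram matrix. Inclusions of column spaces are derived from the
    Loewner order in this way. *)
Lemma psd_sub_gram_ker (m n p k : nat) (K : 'M[R]_(n, k)) (X : 'M[R]_(n, m))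
    (Q : 'M[R]_(p, n)) :
  psdmx (K *m K^T - X *m X^T) -> Q *m K = 0 -> Q *m X = 0.
Proof.
move=> /(psd_conj Q) psd_X QK; apply: psd_neg_gram_eq0.
move: psd_X; rewrite mulmxBr mulmxA QK !mul0mx sub0r mulNmx.
by rewrite trmx_mul !mulmxA.
Qed.

(* Writing X = S W, this is tr ((W - 1)^T S (W - 1)) >= 0 together with
   tr (W^T S W) <= tr S. *)
Lemma psd_tr_le (n : nat) (S X : 'M[R]_n) :
  psdmx S -> psdmx (S *m S - X *m X^T) ->
  \tr X <= \tr S /\ (\tr X = \tr S -> X = S).
Proof.
move=> S_psd XS; have [S_sym _] := S_psd; pose P := pinvmp S.
have [P1 P2 P3 P4] := pinvmpP S.
have [P_sym comm] := penrose_sym S_sym (pinvmpP S).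
rewrite -/P in P1 P2 P3 P4 P_sym comm.
pose W := P *m X; have XE : X = S *m W.
  have : (1%:M - S *m P) *m X = 0.
    apply: psd_sub_gram_ker (_ : psdmx (S *m S^T - _)) _; first by rewrite S_sym.
    by rewrite mulmxBl mul1mx P1 subrr.
  by rewrite mulmxBl mul1mx -mulmxA => /eqP; rewrite subr_eq0 => /eqP.
have W_psd : psdmx (1%:M - W *m W^T).
  rewrite -(subrKA (S *m P)) addrC; apply: psdD; last first.
    by apply: psd_sub_proj => //; rewrite mulmxA P1.
  have := psd_conj P XS; rewrite P_sym mulmxBr mulmxBl /W trmx_mul P_sym !mulmxA.
  by rewrite -comm P1.
have ineq1 := psd_tr_mul_ge0 S_psd W_psd.
have W1_psd := psd_conjT (W - 1%:M) S_psd.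
have trE : \tr ((W - 1%:M)^T *m S *m (W - 1%:M)) =
    \tr (S *m (W *m W^T)) - 2 * \tr X + \tr S.
  have trWSW : \tr (W^T *m S *m W) = \tr (S *m (W *m W^T)).
    by rewrite -mulmxA mxtrace_mulC -mulmxA.
  have trWS : \tr (W^T *m S) = \tr X.
    by rewrite -mxtrace_tr trmx_mul trmxK S_sym -XE.
  rewrite mulmxBr mulmx1 [(_ - _)^T]linearB /= trmx1 !mulmxBl !mul1mx -XE.
  rewrite !linearB /= trWSW trWS; ring.
have ineq2 := psd_tr_ge0 W1_psd; rewrite trE in ineq2.
rewrite mulmxBr mulmx1 linearB /= in ineq1.
split; first lra.
move=> eqXS; have : S *m (W - 1%:M) = 0.
  apply: psd_conj_tr_eq0 => //; rewrite trE; lra.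
by rewrite mulmxBr -XE mulmx1 => /eqP; rewrite subr_eq0 => /eqP.
Qed.

(** Equal Gram matrices give [G' = G Q] with [Q] a partial isometry; [W = M Q^T] works because
    [Q^T Q] is a projection. Couplings of any inner dimension are thus read through the fixed factor
    [G]. *)
Lemma coupling_factor (n k l : nat) (G : 'M[R]_(n, k)) (G' M : 'M[R]_(n, l)) :
  G' *m G'^T = G *m G^T ->
  exists W : 'M[R]_(n, k),
    G' *m M^T = G *m W^T /\ psdmx (M *m M^T - W *m W^T).
Proof.
move=> GG; pose P := pinvmp G; have [P1 P2 P3 P4] := pinvmpP G.
rewrite -/P in P1 P2 P3 P4.
have G'E : G *m P *m G' = G'.
  have : (1%:M - G *m P) *m G' = 0.
    apply: psd_sub_gram_ker (_ : psdmx (G *m G^T - _)) _.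
      by rewrite GG subrr; exact: psd0.
    by rewrite mulmxBl mul1mx P1 subrr.
  by rewrite mulmxBl mul1mx => /eqP; rewrite subr_eq0 => /eqP.
pose Q := P *m G'; have GQ : G *m Q = G' by rewrite mulmxA.
exists (M *m Q^T); rewrite trmx_mul trmxK; split; first by rewrite mulmxA GQ.
have -> : M *m M^T - M *m Q^T *m (Q *m M^T) = M *m (1%:M - Q^T *m Q) *m M^T.
  by rewrite mulmxBr mulmxBl mulmx1 !mulmxA.
apply/psd_conj/psd_sub_proj; first by rewrite trmx_mul trmxK.
have QQ : Q *m Q^T = P *m G.
  rewrite trmx_mul mulmxA -(mulmxA P) GG -!mulmxA -trmx_mul P4.
  by rewrite (mulmxA G) P1.
by rewrite mulmxA -(mulmxA Q^T) QQ -mulmxA -(mulmxA P) GQ.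
Qed.

Lemma coupling_complete (n k : nat) (W : 'M[R]_(n, k)) (B : 'M[R]_n) :
  psdmx (B - W *m W^T) -> exists V : 'M[R]_n,
    row_mx W V *m (row_mx W V)^T = B.
Proof.
move=> /psd_factor [V VE]; exists V.
by rewrite tr_row_mx mul_row_col -VE addrC subrK.
Qed.

Lemma row_mx0_mul (m n p k : nat) (G : 'M[R]_(n, k)) (W : 'M[R]_(m, k))
    (V : 'M[R]_(m, p)) : row_mx G 0 *m (row_mx W V)^T = G *m W^T.
Proof. by rewrite tr_row_mx mul_row_col mul0mx addr0. Qed.

(** The witness is [B G S^+]. With [B = K K^T] and [Z = K^T G] its gap is [K (1 - Z P P Z^T) K^T],
    whose middle factor is the complement of an orthogonal projection. *)
Lemma coupling_opt (n k : nat) (G : 'M[R]_(n, k)) (B : 'M[R]_n) (S : 'M[R]_k) :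
  psdmx B -> psdmx S -> S *m S = G^T *m B *m G ->
  exists W : 'M[R]_(n, k), psdmx (B - W *m W^T) /\ G^T *m W = S.
Proof.
move=> B_psd S_psd SS; have [S_sym _] := S_psd; pose P := pinvmp S.
have [P1 P2 P3 P4] := pinvmpP S.
have [P_sym comm] := penrose_sym S_sym (pinvmpP S).
rewrite -/P in P1 P2 P3 P4 P_sym comm.
exists (B *m G *m P); split; last first.
  by rewrite !mulmxA -SS -mulmxA comm mulmxA P1.
case/psd_factor: B_psd SS => K -> SS; pose Z := K^T *m G.
have ZZ : Z^T *m Z = S *m S by rewrite SS trmx_mul trmxK !mulmxA.
have -> : K *m K^T - K *m K^T *m G *m P *m (K *m K^T *m G *m P)^T =
    K *m (1%:M - Z *m P *m P *m Z^T) *m K^T.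
  by rewrite mulmxBr mulmxBl mulmx1 /Z !trmx_mul !trmxK P_sym !mulmxA.
apply/psd_conj/psd_sub_proj; clearbody Z.
  by rewrite !trmx_mul trmxK P_sym !mulmxA.
have PSSP : P *m P *m (S *m S) *m P *m P = P *m P.
  rewrite -[in RHS]P2 !mulmxA -(mulmxA P P S) -comm mulmxA.
  by rewrite -(mulmxA (P *m S *m P) S P) comm !mulmxA.
rewrite !mulmxA -(mulmxA _ Z^T Z) ZZ; congr (_ *m _).
by rewrite -!(mulmxA Z) PSSP.
Qed.

End Psd.

(** * Fidelity *)

Section Fidelity.
Variables (R : realType) (n : nat).
Implicit Types A B : 'M[R]_n.

Definition fidelity A B : R := \tr (sqrtmx (sqrtmx A *m B *m sqrtmx A)).

Lemma sandwich_psd A B : psdmx A -> psdmx B ->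
  psdmx (sqrtmx A *m B *m sqrtmx A).
Proof.
by move=> /sqrtmxP [[S_sym _] _] /(psd_conj (sqrtmx A)); rewrite S_sym.
Qed.

Lemma coupling_tr_le (k l : nat) B (G : 'M[R]_(n, k)) (S : 'M[R]_k)
    (G' M : 'M[R]_(n, l)) :
  psdmx S -> S *m S = G^T *m B *m G -> G' *m G'^T = G *m G^T ->
  M *m M^T = B ->
  \tr (G' *m M^T) <= \tr S /\
  (\tr (G' *m M^T) = \tr S -> exists W : 'M[R]_(n, k),
     [/\ G' *m M^T = G *m W^T, psdmx (B - W *m W^T) & G^T *m W = S]).
Proof.
move=> S_psd SS GG MM; have [W [WE W_psd]] := coupling_factor M GG.
rewrite MM in W_psd.
have [] := @psd_tr_le _ _ S (G^T *m W) S_psd.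
  by have := psd_conjT G W_psd; rewrite SS mulmxBr mulmxBl trmx_mul trmxK !mulmxA.
have -> : \tr (G^T *m W) = \tr (G' *m M^T).
  by rewrite -mxtrace_tr trmx_mul trmxK mxtrace_mulC WE.
by move=> ? eqS; split=> // /eqS; exists W.
Qed.

(** [tr S] is the maximum of [tr (G M^T)] over couplings, which depends on [G] only through [G G^T];
    the factor [G] is compared with [sqrtmx A]. *)
Lemma fidelityE (k : nat) B (G : 'M[R]_(n, k)) (S : 'M[R]_k) :
  psdmx B -> psdmx S -> S *m S = G^T *m B *m G ->
  fidelity (G *m G^T) B = \tr S.
Proof.
move=> B_psd S_psd SS; pose A := G *m G^T.
have A_psd : psdmx A by exact: psd_gram.
have [[Q_sym Q_ge0] QQ] := sqrtmxP A_psd; set Q := sqrtmx A in Q_sym QQ.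
have [F_psd FF] := sqrtmxP (sandwich_psd A_psd B_psd).
rewrite -/Q in F_psd FF; rewrite /fidelity -/A -/Q.
set F := sqrtmx _ in F_psd FF *; rewrite -{1}Q_sym in FF.
have opt (k1 k2 : nat) (G1 : 'M[R]_(n, k1)) (G2 : 'M[R]_(n, k2)) S1 S2 :
    psdmx S1 -> psdmx S2 -> S1 *m S1 = G1^T *m B *m G1 ->
    S2 *m S2 = G2^T *m B *m G2 -> G1 *m G1^T = G2 *m G2^T -> \tr S1 <= \tr S2.
  move=> S1_psd S2_psd SS1 SS2 GG; have [W [W_psd WE]] := coupling_opt B_psd S1_psd SS1.
  have [V VE] := coupling_complete W_psd.
  have := @coupling_tr_le _ _ B G2 S2 (row_mx G1 0) (row_mx W V) S2_psd SS2.
  rewrite !row_mx0_mul => /(_ GG VE) [+ _]; congr (_ <= _).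
  by rewrite -WE -mxtrace_tr trmx_mul trmxK mxtrace_mulC.
have QQT : Q *m Q^T = G *m G^T by rewrite Q_sym QQ.
apply/le_anti; rewrite (opt _ _ Q G F S) //.
by rewrite (opt _ _ G Q S F) // QQT.
Qed.

Lemma fidelity_ge (k : nat) (G M : 'M[R]_(n, k)) :
  \tr (G *m M^T) <= fidelity (G *m G^T) (M *m M^T).
Proof.
have B_psd := psd_gram M.
have [S_psd SS] := sqrtmxP (psd_conjT G B_psd).
by rewrite (fidelityE B_psd S_psd SS); case: (coupling_tr_le S_psd SS erefl erefl).
Qed.

Lemma fidelity_attained (k : nat) B (G : 'M[R]_(n, k)) : psdmx B ->
  exists2 M : 'M[R]_(n, k + n), M *m M^T = B &
    \tr (row_mx G 0 *m M^T) = fidelity (G *m G^T) B.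
Proof.
move=> B_psd; have [S_psd SS] := sqrtmxP (psd_conjT G B_psd).
have [W [W_psd WE]] := coupling_opt B_psd S_psd SS.
have [V VE] := coupling_complete W_psd.
exists (row_mx W V) => //; rewrite row_mx0_mul (fidelityE B_psd S_psd SS).
by rewrite -WE -mxtrace_tr trmx_mul trmxK mxtrace_mulC.
Qed.

End Fidelity.

(** * Barycenters as images of optimal couplings *)

Section Frobenius.
Variables (R : realType) (n k : nat).
Implicit Types X Y H : 'M[R]_(n, k).

Definition frob X Y : R := \tr (X *m Y^T).

Lemma frobC X Y : frob X Y = frob Y X.
Proof. by rewrite /frob -mxtrace_tr trmx_mul trmxK. Qed.

Lemma frobDl X Y H : frob (X + Y) H = frob X H + frob Y H.
Proof. by rewrite /frob mulmxDl linearD. Qed.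

Lemma frobZl a X H : frob (a *: X) H = a * frob X H.
Proof. by rewrite /frob -scalemxAl linearZ. Qed.

Lemma frobDr X Y H : frob H (X + Y) = frob H X + frob H Y.
Proof. by rewrite frobC frobDl !(frobC H). Qed.

Lemma frobZr a X H : frob H (a *: X) = a * frob H X.
Proof. by rewrite frobC frobZl frobC. Qed.

Lemma frobNl X H : frob (- X) H = - frob X H.
Proof. by rewrite -scaleN1r frobZl mulN1r. Qed.

Lemma frobNr X H : frob H (- X) = - frob H X.
Proof. by rewrite frobC frobNl frobC. Qed.

Definition frobE := (frobDl, frobDr, frobNl, frobNr, frobZl, frobZr).

Lemma frob_barycenter (t : R) X Y H :
  (1 - t) * frob (X - H) (X - H) + t * frob (Y - H) (Y - H) =
  t * (1 - t) * frob (X - Y) (X - Y) +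
  frob (H - ((1 - t) *: X + t *: Y)) (H - ((1 - t) *: X + t *: Y)).
Proof. by rewrite !frobE (frobC H X) (frobC H Y) (frobC Y X); ring. Qed.

Lemma frob_ge0 X : 0 <= frob X X. Proof. exact: gram_tr_ge0. Qed.

Lemma frob_eq0 X : frob X X = 0 -> X = 0. Proof. exact: gram_tr_eq0. Qed.

End Frobenius.

Section Barycenters.
Variables (R : realType) (n : nat).
Implicit Types A B D : 'M[R]_n.

Lemma fidelity_sym A B : psdmx A -> psdmx B -> fidelity A B = fidelity B A.
Proof.
suff le A' B' : psdmx A' -> psdmx B' -> fidelity A' B' <= fidelity B' A'.
  by move=> *; apply/le_anti; rewrite !le.
move=> /psd_factor [K ->] B_psd.
have [M <- <-] := fidelity_attained K B_psd.
rewrite -[\tr _]/(frob (row_mx K 0) M) frobC /frob.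
by have := fidelity_ge M (row_mx K 0); rewrite row_mx0_mul.
Qed.

Lemma W2sq_le (k : nat) (G M : 'M[R]_(n, k)) :
  W2sq (G *m G^T) (M *m M^T) <= frob (G - M) (G - M).
Proof.
rewrite !frobE (frobC M G); have := fidelity_ge G M.
by rewrite /W2sq -/(fidelity _ _) /frob; lra.
Qed.

Lemma W2sqE (k : nat) A B (G M : 'M[R]_(n, k)) :
  G *m G^T = A -> M *m M^T = B -> frob G M = fidelity A B ->
  W2sq A B = frob (G - M) (G - M).
Proof.
move=> GG MM GM; rewrite !frobE (frobC M G) GM /frob GG MM.
by rewrite /W2sq -/(fidelity _ _); ring.
Qed.

(* D = H H^T is optimally coupled to both marginals through the same factor H. *)
Lemma bary_obj_glue (t : R) A B D : psdmx A -> psdmx B -> psdmx D ->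
  exists (k : nat) (G M H : 'M[R]_(n, k)),
    [/\ G *m G^T = A, M *m M^T = B, H *m H^T = D &
      bary_obj t A B D =
        t * (1 - t) * frob (G - M) (G - M) +
        frob (H - ((1 - t) *: G + t *: M)) (H - ((1 - t) *: G + t *: M))].
Proof.
move=> A_psd B_psd D_psd; have [K DE] := psd_factor D_psd.
have [G GG GH] := fidelity_attained K A_psd.
have [M MM MH] := fidelity_attained K B_psd.
pose H := row_mx K (0 : 'M[R]_n).
have HH : H *m H^T = D by rewrite row_mx0_mul DE.
exists (n + n)%N, G, M, H; split=> //.
rewrite -frob_barycenter /bary_obj.
congr (_ * _ + _ * _); apply: W2sqE => //.
  by rewrite frobC fidelity_sym // DE.
by rewrite frobC fidelity_sym // DE.
Qed.

(** By [bary_obj_glue] every value is at least [t (1 - t) W2sq A B], and mixing an optimal pair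
    attains it. At a minimizer both slack terms vanish: [H] is the mixture and [(G, M)] is
    optimal. *)
Lemma barycentersP (t : R) A B (Gam : 'M[R]_n) :
  psdmx A -> psdmx B -> 0 < t < 1 ->
  barycenters t A B Gam <->
  exists (k : nat) (G M : 'M[R]_(n, k)),
    [/\ G *m G^T = A, M *m M^T = B, \tr (G *m M^T) = fidelity A B &
      Gam = ((1 - t) *: G + t *: M) *m ((1 - t) *: G + t *: M)^T].
Proof.
move=> A_psd B_psd /andP [t_gt0 t_lt1].
have t1_gt0 : 0 < 1 - t by rewrite subr_gt0.
have tt_gt0 : 0 < t * (1 - t) by rewrite mulr_gt0.
have obj_ge D : psdmx D -> t * (1 - t) * W2sq A B <= bary_obj t A B D.
  move=> /(bary_obj_glue t A_psd B_psd) [k [G [M [H [<- <- _ ->]]]]].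
  rewrite -[leLHS]addr0 lerD ?frob_ge0 // ler_pM2l //; exact: W2sq_le.
have obj_le k (G M : 'M[R]_(n, k)) : G *m G^T = A -> M *m M^T = B ->
    \tr (G *m M^T) = fidelity A B ->
    bary_obj t A B (((1 - t) *: G + t *: M) *m ((1 - t) *: G + t *: M)^T)
      <= t * (1 - t) * W2sq A B.
  move=> GG MM GM; set H := _ + _; rewrite (W2sqE GG MM GM).
  rewrite -[leRHS]addr0 -[X in _ + X](_ : frob (H - H) (H - H) = 0); last first.
    by rewrite subrr /frob mul0mx mxtrace0.
  rewrite -frob_barycenter /bary_obj -GG -MM.
  by rewrite lerD // ler_pM2l // W2sq_le.
split=> [[Gam_psd Gam_min]|[k [G [M [GG MM GM ->]]]]]; last first.
  split=> [|D D_psd]; first exact: psd_gram.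
  exact: le_trans (obj_le _ _ _ GG MM GM) (obj_ge D D_psd).
have obj_eq : bary_obj t A B Gam <= t * (1 - t) * W2sq A B.
  have [K AE] := psd_factor A_psd.
  have [M MM KM] := fidelity_attained K B_psd.
  have KK : row_mx K (0 : 'M[R]_n) *m (row_mx K 0)^T = A.
    by rewrite row_mx0_mul AE.
  rewrite -AE in KM.
  by apply: le_trans (obj_le _ _ _ KK MM KM); apply: Gam_min; exact: psd_gram.
have [k [G [M [H [GG MM HH objE]]]]] := bary_obj_glue t A_psd B_psd Gam_psd.
have H_ge0 := frob_ge0 (H - ((1 - t) *: G + t *: M)).
have GM_le : W2sq A B <= frob (G - M) (G - M) by rewrite -GG -MM W2sq_le.
have GM_le' : t * (1 - t) * W2sq A B <= t * (1 - t) * frob (G - M) (G - M).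
  by rewrite ler_pM2l.
rewrite objE in obj_eq; exists k, G, M; split=> //; last first.
  rewrite -HH; suff -> : H = (1 - t) *: G + t *: M by [].
  by apply/eqP; rewrite -subr_eq0; apply/eqP/frob_eq0; lra.
have : frob (G - M) (G - M) = W2sq A B.
  by apply/le_anti; rewrite GM_le andbT -(ler_pM2l tt_gt0); lra.
rewrite !frobE (frobC M G) /W2sq -/(fidelity A B) /frob GG MM; lra.
Qed.

Lemma mix_gram (k : nat) (t : R) (G W : 'M[R]_(n, k)) :
  ((1 - t) *: G + t *: W) *m ((1 - t) *: G + t *: W)^T =
  (1 - t) ^+ 2 *: (G *m G^T) + t ^+ 2 *: (W *m W^T) +
    (t * (1 - t)) *: (G *m W^T + W *m G^T).
Proof.
rewrite [(_ + _)^T]linearD !linearZ /= mulmxDl !mulmxDr.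
rewrite -!scalemxAl -!scalemxAr !scalerA.
move: (G *m G^T) (W *m W^T) (G *m W^T) (W *m G^T) => X1 X2 X3 X4.
by apply/matrixP => i j; rewrite !mxE; ring.
Qed.

End Barycenters.

(** * Rank-one deflation and factors with few columns *)

Lemma psd_quad_eq0 (R : realType) (n : nat) (D : 'M[R]_n) (v : 'cV[R]_n) :
  psdmx D -> (v^T *m D *m v) 0 0 = 0 -> D *m v = 0.
Proof.
move=> D_psd v0; apply: psd_conj_eq0 => //.
by apply/matrixP => i j; rewrite !ord1 v0 mxE.
Qed.

(** Take [v] with [D v <> 0] and [w = D v / sqrt (v^T D v)]. The difference stays positive because
    it is [K (1 - p) K^T] with [D = K K^T] and [p] a rank-one projection, and its kernel gains
    [v]. *)
Lemma psd_deflate (R : realType) (n : nat) (D : 'M[R]_n) :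
  psdmx D -> D != 0 -> exists w : 'cV[R]_n,
    [/\ w != 0, (w^T <= D)%MS, psdmx (D - w *m w^T) &
        (\rank (D - w *m w^T)%R < \rank D)%N].
Proof.
move=> D_psd D_neq0; have [D_sym D_ge0] := D_psd.
have [v Dv_neq0] : exists v : 'cV[R]_n, D *m v != 0.
  apply: contrapT => /forallNP Dv0; case/negP: D_neq0; apply/eqP/matrixP => i j.
  have /negP/negPn/eqP := Dv0 (delta_mx j 0).
  by rewrite -colE => /matrixP/(_ i 0); rewrite !mxE.
pose a := (v^T *m D *m v) 0 0.
have vDv : v^T *m D *m v = a%:M.
  by apply/matrixP => i j; rewrite !ord1 [RHS]mxE eqxx.
have a_gt0 : 0 < a.
  rewrite lt_neqAle D_ge0 andbT eq_sym; apply: contra Dv_neq0 => /eqP a0.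
  by apply/eqP/psd_quad_eq0.
pose b := (Num.sqrt a)^-1; have bb : b * b = a^-1.
  by rewrite -invfM -expr2 sqr_sqrtr // ltW.
have b_neq0 : b != 0 by rewrite invr_eq0 sqrtr_eq0 -ltNge.
pose w := b *: (D *m v); have wT : w^T = b *: (v^T *m D).
  by rewrite linearZ /= trmx_mul D_sym.
have ww : w *m w^T = a^-1 *: (D *m v *m v^T *m D).
  by rewrite wT -scalemxAl -scalemxAr scalerA bb !mulmxA.
have kill : (D - w *m w^T) *m v = 0.
  rewrite ww mulmxBl -scalemxAl -!mulmxA (mulmxA v^T) vDv mul_mx_scalar.
  by rewrite -scalemxAr scalerA mulVf ?scale1r ?subrr // gt_eqF.
exists w; split.
- by rewrite scaler_eq0 negb_or b_neq0.
- by rewrite wT scalemx_sub // submxMl.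
- have [K DE] := psd_factor D_psd; pose z := K^T *m v.
  have zz : z^T *m z = a%:M by rewrite -vDv DE trmx_mul trmxK !mulmxA.
  have -> : D - w *m w^T = K *m (1%:M - a^-1 *: (z *m z^T)) *m K^T.
    rewrite mulmxBr mulmx1 mulmxBl -DE ww -scalemxAr -scalemxAl; congr (_ - _ *: _).
    by rewrite /z trmx_mul trmxK DE !mulmxA.
  clearbody z; apply/psd_conj/psd_sub_proj.
    by rewrite linearZ /= trmx_mul trmxK.
  rewrite -scalemxAl -scalemxAr scalerA mulmxA -(mulmxA z) zz mul_mx_scalar.
  by rewrite -scalemxAl scalerA mulfVK // gt_eqF.
- apply: rank_ltmx; rewrite ltmxE; apply/andP; split.
    by rewrite addmx_sub // eqmx_opp wT -scalemxAr scalemx_sub // mulmxA submxMl.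
  apply: contra Dv_neq0 => /submxP [X DX].
  by rewrite DX -mulmxA kill mulmx0.
Qed.

(** Each deflation vector supplies one column while the rank falls. *)
Lemma psd_rank_factor (R : realType) (n m : nat) (A : 'M[R]_n) :
  psdmx A -> (\rank A <= m)%N -> exists G : 'M[R]_(n, m), G *m G^T = A.
Proof.
elim: m A => [|m IHm] A A_psd.
  by rewrite leqn0 mxrank_eq0 => /eqP ->; exists 0; rewrite mul0mx.
have [->|A_neq0] := eqVneq A 0; first by exists 0; rewrite mul0mx.
have [w [_ _ w_psd w_rank]] := psd_deflate A_psd A_neq0; move=> rA.
have [|G GE] := IHm _ w_psd; first by rewrite -ltnS (leq_trans w_rank).
have HE : row_mx w G *m (row_mx w G)^T = A.
  by rewrite tr_row_mx mul_row_col GE addrC subrK.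
by exists (row_mx w G).
Qed.

Lemma left_inverse_factor (R : realType) (n r : nat) (G : 'M[R]_(n, r)) :
  \rank (G *m G^T) = r -> exists L : 'M[R]_(r, n), L *m G = 1%:M.
Proof.
move=> rG; apply/row_fullP; rewrite /row_full eqn_leq rank_leq_col /=.
by rewrite -{1}rG mxrankM_maxl.
Qed.

(** * Barycenters as the affine image of a convex set of factors [W] *)

Section Parametrization.
Variables (R : realType) (n r : nat) (A B : 'M[R]_n) (t : R).
Variables (G : 'M[R]_(n, r)) (L : 'M[R]_(r, n)) (S : 'M[R]_r).
Hypothesis t01 : 0 < t < 1.
Hypothesis GG : G *m G^T = A.
Hypothesis LG : L *m G = 1%:M.
Hypothesis B_psd : psdmx B.
Hypothesis S_psd : psdmx S.
Hypothesis SS : S *m S = G^T *m B *m G.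
Implicit Types W : 'M[R]_(n, r).

(* W stands for the optimal coupling G W^T of A and B. *)
Definition opt_factor W := G^T *m W = S /\ psdmx (B - W *m W^T).

(** The Gram matrix of [(1 - t) *: G + t *: W] with [W *m W^T] replaced by [B], which makes it
    affine in [W]. *)
Definition interp W : 'M[R]_n :=
  (1 - t) ^+ 2 *: A + t ^+ 2 *: B + (t * (1 - t)) *: (G *m W^T + W *m G^T).

Let A_psd : psdmx A. Proof. by rewrite -GG; exact: psd_gram. Qed.

Let fidE : fidelity A B = \tr S.
Proof. by rewrite -GG (fidelityE B_psd S_psd SS). Qed.

Let S_sym : S^T = S. Proof. by case: S_psd. Qed.

Let GL : G^T *m L^T = 1%:M. Proof. by rewrite -trmx_mul LG trmx1. Qed.

Lemma tr_coupling W : G^T *m W = S -> \tr (G *m W^T) = fidelity A B.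
Proof. by move=> WE; rewrite -mxtrace_tr trmx_mul trmxK mxtrace_mulC WE fidE. Qed.

(** The Gram matrix of a mixture involves only the marginals and the cross term; equality in
    [coupling_tr_le] turns that term into [G W^T], and [coupling_complete] leads back. *)
Lemma barycenters_opt Gam :
  barycenters t A B Gam <-> exists2 W, opt_factor W & Gam = interp W.
Proof.
split=> [/(barycentersP _ A_psd B_psd t01) [k [G' [M [GG' MM tr GamE]]]]|].
  have GGG : G' *m G'^T = G *m G^T by rewrite GG.
  have [_] := coupling_tr_le S_psd SS GGG MM.
  rewrite tr fidE => /(_ erefl) [W [WE W_psd WS]]; exists W => //.
  rewrite GamE mix_gram GG' MM WE; congr (_ + _ *: (_ + _)).
  by rewrite -[M *m _]trmxK trmx_mul trmxK WE trmx_mul trmxK.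
case=> W [WE W_psd] ->; have [V VE] := coupling_complete W_psd.
apply/(barycentersP _ A_psd B_psd t01).
have GG0 : row_mx G (0 : 'M[R]_n) *m (row_mx G 0)^T = A.
  by rewrite row_mx0_mul GG.
exists (r + n)%N, (row_mx G 0), (row_mx W V); split=> //.
  by rewrite row_mx0_mul tr_coupling.
rewrite mix_gram GG0 VE row_mx0_mul; congr (_ + _ *: (_ + _)).
by rewrite tr_row_mx trmx0 mul_row_col mulmx0 addr0.
Qed.

(** The dictionary is [W = T G] and, through the left inverse, [T = W L]. *)
Lemma mccann_opt Gam :
  mccann t A B Gam <->
  exists2 W, opt_factor W & W *m W^T = B /\ Gam = interp W.
Proof.
have mixE T W : T *m G = W -> W *m W^T = B ->
    ((1 - t)%:M + t *: T) *m A *m ((1 - t)%:M + t *: T)^T = interp W.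
  move=> TG WW; rewrite -GG mulmxA -mulmxA -trmx_mul mulmxDl mul_scalar_mx.
  by rewrite -scalemxAl TG mix_gram WW GG.
split=> [[T [TA trT] ->]|[W [WE W_psd] [WW ->]]].
  pose W := T *m G; have WW : W *m W^T = B.
    by rewrite trmx_mul mulmxA -(mulmxA T) GG.
  have [_] := coupling_tr_le S_psd SS erefl WW.
  rewrite -[\tr (sqrtmx _)]/(fidelity A B) fidE in trT.
  have -> : \tr (G *m W^T) = \tr S.
    by rewrite trmx_mul mulmxA GG -mxtrace_tr trmx_mul trmxK mxtrace_mulC
      (proj1 A_psd) trT.
  case=> // W' [/(congr1 (mulmx L))]; rewrite !mulmxA LG !mul1mx.
  by move/trmx_inj => <- W_psd WS; exists W => //; split=> //; exact: mixE.
have WLG : W *m L *m G = W by rewrite -mulmxA LG mulmx1.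
exists (W *m L); last by rewrite (mixE _ _ WLG WW).
split; first by rewrite -GG mulmxA WLG -mulmxA -trmx_mul WLG.
rewrite -[RHS]/(fidelity A B) fidE -GG -mulmxA (mulmxA G^T) WE.
by rewrite mulmxA mxtrace_mulC mulmxA LG mul1mx.
Qed.

(** For [D = W - W'] one has [G^T D = 0], so multiplying the equality of cross terms by [L] on the
    left and by [D] on the right leaves [D^T D = 0]. *)
Lemma interp_inj W W' :
  opt_factor W -> opt_factor W' -> interp W = interp W' -> W = W'.
Proof.
case=> WE _ [WE' _] /addrI; have /andP [t_gt0 t_lt1] := t01.
have tt_neq0 : t * (1 - t) != 0 by rewrite gt_eqF // mulr_gt0 // subr_gt0.
have [D DE] : exists D, D = W - W' by exists (W - W').
have GD : G^T *m D = 0 by rewrite DE mulmxBr WE WE' subrr.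
move/(scalerI tt_neq0)/(congr1 (fun X => L *m X *m D)).
rewrite !mulmxDr !mulmxDl -!mulmxA GD !mulmx0 !addr0 !(mulmxA L G) LG !mul1mx.
move/eqP; rewrite -subr_eq0 -mulmxBl -linearB /= -DE => /eqP/gramT_eq0/eqP.
by rewrite DE subr_eq0 => /eqP.
Qed.

Lemma interp_mix W W' a :
  interp ((1 - a) *: W + a *: W') = (1 - a) *: interp W + a *: interp W'.
Proof.
rewrite /interp [(_ + _)^T]linearD !linearZ /= mulmxDr mulmxDl -!scalemxAl -!scalemxAr.
move: (G *m W^T) (G *m W'^T) (W *m G^T) (W' *m G^T) => X1 X2 X3 X4.
by apply/matrixP => i j; rewrite !mxE; ring.
Qed.

(** The last term measures the strict concavity of the gap: it yields convexity of the set of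
    optimal factors and, when the left side vanishes, extremality. *)
Lemma gap_mix W W' a :
  let V := (1 - a) *: W + a *: W' in
  B - V *m V^T = (1 - a) *: (B - W *m W^T) + a *: (B - W' *m W'^T) +
    (a * (1 - a)) *: ((W - W') *m (W - W')^T).
Proof.
move=> V; rewrite mix_gram [(W - W')^T]linearB /= mulmxBl !mulmxBr.
move: (W *m W^T) (W *m W'^T) (W' *m W^T) (W' *m W'^T) => X1 X2 X3 X4.
by apply/matrixP => i j; rewrite !mxE; ring.
Qed.

Lemma opt_factor_convex W W' a : 0 <= a <= 1 ->
  opt_factor W -> opt_factor W' -> opt_factor ((1 - a) *: W + a *: W').
Proof.
move=> /andP [a0 a1] [WE W_psd] [WE' W_psd']; split.
  by rewrite mulmxDr -!scalemxAr WE WE' -scalerDl subrK scale1r.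
have a1' : 0 <= 1 - a by rewrite subr_ge0.
rewrite gap_mix; apply: psdD; last first.
  by apply: psdZ; [rewrite mulr_ge0|exact: psd_gram].
by apply: psdD; apply: psdZ.
Qed.

Lemma opt_factor_extreme W W1 W2 a : W *m W^T = B -> 0 < a < 1 ->
  opt_factor W1 -> opt_factor W2 -> W = (1 - a) *: W1 + a *: W2 -> W1 = W2.
Proof.
move=> WW /andP [a0 a1] [_ W1_psd] [_ W2_psd] WE.
have a1' : 0 < 1 - a by rewrite subr_gt0.
have aa : 0 < a * (1 - a) by rewrite mulr_gt0.
have /= := gap_mix W1 W2 a; rewrite -WE WW subrr => /esym/eqP.
rewrite addr_eq0 => /eqP gapE.
apply/eqP; rewrite -subr_eq0; apply/eqP/psd_neg_gram_eq0.
rewrite -[_ *m _]scale1r -(mulVf (lt0r_neq0 aa)) -scalerA -scalerN -gapE.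
by apply: psdZ; rewrite ?invr_ge0 ?ltW //; apply: psdD; apply: psdZ => //; exact: ltW.
Qed.

(** [G^T D G = S S - S S = 0] for the gap [D], and a positive matrix annihilates the vectors on
    which its form vanishes. *)
Lemma gap_kernel W : opt_factor W -> G^T *m (B - W *m W^T) = 0.
Proof.
case=> WS D_psd; have D_sym := proj1 D_psd.
rewrite -[LHS]trmxK trmx_mul trmxK D_sym psd_conj_eq0 ?trmx0 //.
have WG : W^T *m G = S by rewrite -S_sym -WS trmx_mul trmxK.
by rewrite mulmxBr mulmxBl -SS mulmxA WS -mulmxA WG subrr.
Qed.

Hypothesis rank_B : (\rank B <= r)%N.

(* Moving W along w u^T with W u = c w only changes the gap B - W W^T by a
   multiple of w w^T; both ends of the segment on which the gap stays positive
   have a gap of smaller rank. *)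
Lemma opt_factor_segment W : opt_factor W -> B - W *m W^T != 0 ->
  exists W1 W2 (a : R),
    [/\ opt_factor W1 /\ (\rank (B - W1 *m W1^T)%R < \rank (B - W *m W^T)%R)%N,
        opt_factor W2 /\ (\rank (B - W2 *m W2^T)%R < \rank (B - W *m W^T)%R)%N,
        0 < a < 1, W = (1 - a) *: W1 + a *: W2 & W1 <> W].
Proof.
move=> W_opt D_neq0; have [WS D_psd] := W_opt.
set D := B - W *m W^T in D_psd D_neq0 *.
have [w [w_neq0 wD w_psd w_rank]] := psd_deflate D_psd D_neq0.
have Gw : G^T *m w = 0.
  case/submxP: wD => v /(congr1 trmx); rewrite trmxK trmx_mul (proj1 D_psd) => ->.
  by rewrite mulmxA gap_kernel // mul0mx.
have WB : (W^T <= B)%MS.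
  have [K BE] := psd_factor B_psd; pose Q := (cokermx B)^T.
  have QB : Q *m B = 0.
    by rewrite -[LHS]trmxK trmx_mul trmxK (proj1 B_psd) mulmx_coker trmx0.
  rewrite submxE -[X in X == _]trmxK trmx_mul trmxK -/Q.
  rewrite (@psd_sub_gram_ker _ _ _ _ _ K _ Q) ?trmx0 // -?BE //.
  by apply: gram_eq0; rewrite trmx_mul mulmxA -(mulmxA Q) -BE QB mul0mx.
have wB : (w^T <= B)%MS.
  by rewrite (submx_trans wD) // addmx_sub // eqmx_opp mulmx_sub.
(* The [r + 1] rows of [col_mx W^T w^T] lie in a space of dimension at most [r], so they are
   linearly dependent. *)
have [z zY z_neq0] : exists2 z : 'rV[R]_(r + 1), z *m col_mx W^T w^T = 0 & z != 0.
  have /rowV0Pn [z /sub_kermxP zY z_neq0] : kermx (col_mx W^T w^T) != 0.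
    rewrite -mxrank_eq0 mxrank_ker -lt0n subn_gt0.
    apply: (@leq_ltn_trans r); last by rewrite addn1.
    by apply: leq_trans rank_B; rewrite mxrankS // col_mx_sub WB.
  by exists z.
pose u := (lsubmx z)^T; pose c := - rsubmx z 0 0.
have Wu : W *m u = c *: w.
  move: zY; rewrite -[z]hsubmxK mul_row_col => /(congr1 trmx) /eqP.
  rewrite linearD /= !trmx_mul !trmxK trmx0 addr_eq0 => /eqP ->.
  by rewrite [rsubmx z]mx11_scalar tr_scalar_mx mul_mx_scalar /c scaleNr.
have u_neq0 : u != 0.
  apply: contra z_neq0 => /eqP u0; move: Wu; rewrite u0 mulmx0 => /esym/eqP.
  rewrite scaler_eq0 (negPf w_neq0) orbF oppr_eq0 => /eqP z2.
  rewrite -[z]hsubmxK [rsubmx z]mx11_scalar z2 -[lsubmx z]trmxK -/u u0.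
  by rewrite trmx0 raddf0 row_mx0.
pose q := (u^T *m u) 0 0.
have uu : u^T *m u = q%:M by apply/matrixP => i j; rewrite !ord1 [RHS]mxE eqxx.
have q_gt0 : 0 < q.
  rewrite lt_neqAle vdot_ge0 andbT eq_sym; apply: contra u_neq0 => /eqP q0.
  by apply/eqP/vdot_eq0.
(* Along [w u^T] the product [W W^T] grows by [(q l^2 + 2 c l) w w^T]; coefficient 1 turns the gap
   into the deflated matrix. *)
have gapE l : q * l ^+ 2 + 2 * c * l = 1 ->
    opt_factor (W + l *: (w *m u^T)) /\
    (\rank (B - (W + l *: (w *m u^T)) *m (W + l *: (w *m u^T))^T)%R
      < \rank D)%N.
  move=> lE; have DE : B - (W + l *: (w *m u^T)) *m (W + l *: (w *m u^T))^T =
      D - w *m w^T.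
    have -> : (W + l *: (w *m u^T))^T = W^T + l *: (u *m w^T).
      by rewrite linearD linearZ /= trmx_mul trmxK.
    have uW : u^T *m W^T = c *: w^T by rewrite -trmx_mul Wu linearZ.
    rewrite mulmxDl !mulmxDr -!scalemxAl -!scalemxAr mulmxA Wu -!mulmxA uW.
    rewrite (mulmxA u^T u) uu mul_scalar_mx -!scalemxAl -!scalemxAr !scalerA.
    rewrite -[X in D - X]scale1r -lE /D.
    move: (W *m W^T) (w *m w^T) => X1 X2.
    by apply/matrixP => i j; rewrite !mxE; ring.
  split; last by rewrite DE.
  split; last by rewrite DE.
  by rewrite mulmxDr -scalemxAr mulmxA Gw mul0mx scaler0 addr0.
pose s := Num.sqrt (c ^+ 2 + q).
have ss : s ^+ 2 = c ^+ 2 + q by rewrite sqr_sqrtr // addr_ge0 ?sqr_ge0 ?ltW.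
have s_gt0 : 0 < s by rewrite sqrtr_gt0 ltr_wpDl ?sqr_ge0.
have q_neq0 : q != 0 by rewrite gt_eqF.
have root_eq l : (q * l + c) ^+ 2 = s ^+ 2 -> q * l ^+ 2 + 2 * c * l = 1.
  rewrite ss => lE; apply: (mulfI q_neq0); rewrite mulr1.
  by apply: (addrI (c ^+ 2)); rewrite -lE; ring.
have /andP [s_lt s_gt] : - s < c < s.
  by rewrite -ltr_norml -sqrtr_sqr ltr_sqrt ?ltrDl // ltr_wpDl ?sqr_ge0.
(* [l1] and [l2] are the roots of [q l^2 + 2 c l = 1], of opposite signs since [|c| < s]; [a] is the
   weight at which they average to 0. *)
pose l1 := (- s - c) / q; pose l2 := (s - c) / q; pose a := (s + c) / (2 * s).
exists (W + l1 *: (w *m u^T)), (W + l2 *: (w *m u^T)), a; split.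
- by apply/gapE/root_eq; rewrite /l1 mulrCA divff //; ring.
- by apply/gapE/root_eq; rewrite /l2 mulrCA divff //; ring.
- by rewrite /a divr_gt0 ?ltr_pdivrMr; lra.
- rewrite !scalerDr addrACA -scalerDl subrK scale1r !scalerA -scalerDl.
  suff -> : (1 - a) * l1 + a * l2 = 0 by rewrite scale0r addr0.
  by rewrite /a /l1 /l2; field; rewrite q_neq0 gt_eqF.
- move/eqP; rewrite -subr_eq0 [W + _]addrC addrK scaler_eq0 => /orP [].
    by rewrite mulf_eq0 invr_eq0 (negPf q_neq0) orbF => /eqP; lra.
  move=> /eqP/(congr1 (fun X => X *m u)); rewrite mul0mx -mulmxA uu.
  by move/eqP; rewrite mul_mx_scalar scaler_eq0 (negPf q_neq0) (negPf w_neq0).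
Qed.

Let convex_interp W W1 W2 a : W = (1 - a) *: W1 + a *: W2 ->
  interp W = (1 - a) *: interp W1 + a *: interp W2.
Proof. by move=> ->; exact: interp_mix. Qed.

Lemma extreme_mccann Gam :
  extreme_point (barycenters t A B) Gam <-> mccann t A B Gam.
Proof.
split=> [[/barycenters_opt [W W_opt GamE] Gam_ext]|].
  apply/mccann_opt; exists W => //; split=> //; apply/eqP.
  rewrite eq_sym -subr_eq0; apply/negP => /negP D_neq0.
  have [W1 [W2 [a [[opt1 _] [opt2 _] a01 WE W1W]]]] :=
    opt_factor_segment W_opt D_neq0.
  have bary W' : opt_factor W' -> barycenters t A B (interp W').
    by move=> ?; apply/barycenters_opt; exists W'.
  have [] := Gam_ext (interp W1) (interp W2) a (bary _ opt1) (bary _ opt2) a01.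
    by rewrite GamE; exact: convex_interp.
  by rewrite GamE => /(interp_inj opt1 W_opt).
move=> /mccann_opt [W W_opt [WW ->]]; split; first by apply/barycenters_opt; exists W.
move=> _ _ a /barycenters_opt [W1 opt1 ->] /barycenters_opt [W2 opt2 ->] a01.
have /andP [a0 a1] := a01; have a01' : 0 <= a <= 1 by rewrite !ltW.
(* Injectivity of [interp] moves the convex decomposition from barycenters to factors. *)
rewrite -interp_mix => /(interp_inj W_opt (opt_factor_convex a01' opt1 opt2)) WE.
have W12 := opt_factor_extreme WW a01 opt1 opt2 WE.
by move: WE; rewrite W12 -scalerDl subrK scale1r => ->.
Qed.

(** Strong induction on the rank of the gap: a nonzero gap splits [W] into two factors with gaps of
    smaller rank, and gap zero means a McCann interpolant. Every barycenter is thus a finite convex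
    combination of these. *)
Lemma barycenters_sub_hull (K : set 'M[R]_n) :
  (forall X Y (a : R), 0 < a < 1 -> K X -> K Y -> K ((1 - a) *: X + a *: Y)) ->
  mccann t A B `<=` K -> barycenters t A B `<=` K.
Proof.
move=> K_convex mK _ /barycenters_opt [W W_opt ->].
have [m] := ubnP (\rank (B - W *m W^T)); elim: m W W_opt => // m IHm W W_opt.
rewrite ltnS => rW; have [D0|D_neq0] := eqVneq (B - W *m W^T) 0.
  apply: mK; apply/mccann_opt; exists W => //; split=> //.
  by apply/esym/eqP; rewrite -subr_eq0 D0.
have [W1 [W2 [a [[opt1 r1] [opt2 r2] a01 WE _]]]] :=
  opt_factor_segment W_opt D_neq0.
rewrite (convex_interp WE); apply: K_convex => //.
  by apply: IHm => //; exact: leq_trans r1 rW.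
by apply: IHm => //; exact: leq_trans r2 rW.
Qed.

Lemma barycenters_convex X Y (a : R) : 0 <= a <= 1 ->
  barycenters t A B X -> barycenters t A B Y ->
  barycenters t A B ((1 - a) *: X + a *: Y).
Proof.
move=> a01 /barycenters_opt [W1 opt1 ->] /barycenters_opt [W2 opt2 ->].
apply/barycenters_opt; rewrite -interp_mix.
by exists ((1 - a) *: W1 + a *: W2) => //; exact: opt_factor_convex.
Qed.

End Parametrization.

(** * Closedness and the convex hull *)

Section MatrixContinuity.
Variables (R : realType) (n : nat).

Definition mxcont (p q : nat) (F : 'M[R]_n -> 'M[R]_(p, q)) :=
  forall i j, continuous (fun X => F X i j : R).

Lemma mxcont_id : mxcont id. Proof. by move=> i j; exact: coord_continuous. Qed.

Lemma mxcont_cst (p q : nat) (M : 'M[R]_(p, q)) : mxcont (fun=> M).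
Proof. by move=> i j; exact: cst_continuous. Qed.

Lemma mxcontD (p q : nat) (F H : 'M[R]_n -> 'M[R]_(p, q)) :
  mxcont F -> mxcont H -> mxcont (fun X => F X + H X).
Proof.
move=> Fc Hc i j; under [fun X => _]funext do rewrite mxE.
by move=> X; apply: continuousD; [exact: Fc|exact: Hc].
Qed.

Lemma mxcontM (p q s : nat) (F : 'M[R]_n -> 'M[R]_(p, q))
    (H : 'M[R]_n -> 'M[R]_(q, s)) :
  mxcont F -> mxcont H -> mxcont (fun X => F X *m H X).
Proof.
move=> Fc Hc i j; under [fun X => _]funext do rewrite mxE.
apply: continuous_big => [|k _ X]; first exact: add_continuous.
by apply: continuousM; [exact: Fc|exact: Hc].
Qed.

Lemma mxcontZ (p q : nat) (a : R) (F : 'M[R]_n -> 'M[R]_(p, q)) :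
  mxcont F -> mxcont (fun X => a *: F X).
Proof.
move=> Fc; under [fun X => _]funext do rewrite -mul_scalar_mx.
by apply: mxcontM => //; exact: mxcont_cst.
Qed.

Lemma mxcontB (p q : nat) (F H : 'M[R]_n -> 'M[R]_(p, q)) :
  mxcont F -> mxcont H -> mxcont (fun X => F X - H X).
Proof.
move=> Fc Hc; under [fun X => _]funext do rewrite -scaleN1r.
by apply: mxcontD => //; exact: mxcontZ.
Qed.

Lemma mxcont_tr (p q : nat) (F : 'M[R]_n -> 'M[R]_(p, q)) :
  mxcont F -> mxcont (fun X => (F X)^T).
Proof. by move=> Fc i j; under [fun X => _]funext do rewrite mxE; exact: Fc. Qed.

Lemma closed_eqmx (p q : nat) (F H : 'M[R]_n -> 'M[R]_(p, q)) :
  mxcont F -> mxcont H -> closed [set X | F X = H X].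
Proof.
move=> Fc Hc; rewrite (_ : [set X | _] = \bigcap_(ij : 'I_p * 'I_q)
    (fun X => (F X - H X) ij.1 ij.2) @^-1` [set 0]).
  apply: closed_bigI => -[i j] _; apply: preimage_closed; last exact: closed_eq.
  by move=> X _; exact: mxcontB.
apply/seteqP; split=> X /= E; first by move=> ij _ /=; rewrite E subrr mxE.
apply/matrixP => i j; apply/eqP; rewrite -subr_eq0; apply/eqP.
by have := E (i, j) I; rewrite /= !mxE.
Qed.

Lemma closed_psd (p : nat) (F : 'M[R]_n -> 'M[R]_p) :
  mxcont F -> closed [set X | psdmx (F X)].
Proof.
move=> Fc; rewrite (_ : [set X | _] = [set X | (F X)^T = F X] `&`
    \bigcap_(v : 'cV[R]_p) (fun X => (v^T *m F X *m v) 0 0) @^-1` [set x | 0 <= x]).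
  apply: closedI; first by apply: closed_eqmx => //; exact: mxcont_tr.
  apply: closed_bigI => v _; apply: preimage_closed; last exact: closed_ge.
  move=> X _; apply: (@mxcontM _ _ _ (fun X => v^T *m F X)) => //.
    by apply: mxcontM => //; exact: mxcont_cst.
  exact: mxcont_cst.
apply/seteqP; split=> X /= [E1 E2]; split=> // v; first by move=> _; exact: E2.
exact: E2.
Qed.

End MatrixContinuity.

Lemma gram_unit (R : realType) (n r : nat) (G : 'M[R]_(n, r)) (L : 'M[R]_(r, n)) :
  L *m G = 1%:M -> G^T *m G \in unitmx.
Proof.
move=> LG; rewrite -row_free_unit; apply/inj_row_free => v vGG.
suff vG : v *m G^T = 0.
  by rewrite -[v]mulmx1 -trmx1 -LG trmx_mul mulmxA vG mul0mx.
apply: gram_eq0; rewrite trmx_mul trmxK -mulmxA (mulmxA G^T).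
by rewrite mulmxA vGG mul0mx.
Qed.

Section Hull.
Variables (R : realType) (n r : nat) (A B : 'M[R]_n) (t : R).
Variables (G : 'M[R]_(n, r)) (L : 'M[R]_(r, n)) (S : 'M[R]_r).
Hypothesis t01 : 0 < t < 1.
Hypothesis GG : G *m G^T = A.
Hypothesis LG : L *m G = 1%:M.
Hypothesis B_psd : psdmx B.
Hypothesis S_psd : psdmx S.
Hypothesis SS : S *m S = G^T *m B *m G.

(* The affine left inverse of interp on optimal factors. *)
Let factor (X : 'M[R]_n) : 'M[R]_(n, r) :=
  ((t * (1 - t))^-1 *: (X - ((1 - t) ^+ 2 *: A + t ^+ 2 *: B)) *m G - G *m S)
    *m invmx (G^T *m G).

(** Here [W^T G = S], so [(G W^T + W G^T) G = G S + W (G^T G)], which is solved for [W]. *)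
Let factorK W : opt_factor B G S W -> factor (interp A B t G W) = W.
Proof.
have /andP [t_gt0 t_lt1] := t01; case=> WS _.
have tt_neq0 : t * (1 - t) != 0 by rewrite gt_eqF // mulr_gt0 // subr_gt0.
have WG : W^T *m G = S by rewrite -(proj1 S_psd) -WS trmx_mul trmxK.
rewrite /factor /interp [_ + (t * _) *: _]addrC addrK scalerA mulVf //.
rewrite scale1r [(_ + _) *m G]mulmxDl -(mulmxA G) WG [G *m S + _]addrC addrK -(mulmxA W).
by rewrite mulmxK // (gram_unit LG).
Qed.

(** Through the continuous map [factor], being a barycenter becomes two matrix equations and one
    positivity condition on [X]. *)
Lemma barycenters_closed : closed (barycenters t A B).
Proof.
have bary := barycenters_opt t01 GG B_psd S_psd SS.
rewrite (_ : barycenters t A B =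
    [set X | G^T *m factor X = S] `&`
    [set X | psdmx (B - factor X *m (factor X)^T)] `&`
    [set X | interp A B t G (factor X) = X]); last first.
  apply/seteqP; split=> X; last first.
    by case=> -[? ?] /= XE; apply/bary; exists (factor X).
  by case/bary=> W W_opt ->; rewrite /= factorK.
have factor_c : mxcont factor.
  apply: mxcontM; last exact: mxcont_cst.
  apply: mxcontB; last exact: mxcont_cst.
  apply: mxcontM; last exact: mxcont_cst.
  apply: mxcontZ; apply: mxcontB; last exact: mxcont_cst.
  exact: mxcont_id.
have factorT_c := mxcont_tr factor_c.
apply: closedI; [apply: closedI|].
- by apply: closed_eqmx; [apply: mxcontM => //|]; exact: mxcont_cst.
- by apply: closed_psd; apply: mxcontB; [exact: mxcont_cst|exact: mxcontM].
- apply: closed_eqmx; last exact: mxcont_id.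
  apply: mxcontD; first exact: mxcont_cst.
  by apply: mxcontZ; apply: mxcontD; apply: mxcontM => //; exact: mxcont_cst.
Qed.

Lemma barycenters_hull : (\rank B <= r)%N ->
  barycenters t A B = closed_convex_hull (mccann t A B).
Proof.
move=> rank_B; apply/seteqP; split.
  move=> X X_bary K [[_ K_convex] mK].
  apply: (barycenters_sub_hull t01 GG LG B_psd S_psd SS rank_B _ mK X_bary).
  move=> Y Z a a01 KY KZ; have a01' : 0 <= a <= 1.
    by case/andP: a01 => *; rewrite !ltW.
  (* [conv] puts the weight [a] on its first argument, hence the order [Z], [Y]. *)
  have := K_convex Z Y (Itv01 (proj1 (andP a01')) (proj2 (andP a01'))).
  by rewrite !inE => /(_ KZ KY); rewrite /conv /= addrC.
apply: smallest_sub.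
  split; first exact: barycenters_closed.
  move=> Y Z a; rewrite !inE => KY KZ.
  rewrite /conv /= addrC.
  apply: (barycenters_convex t01 GG B_psd S_psd SS) => //.
  by rewrite ge0 le1.
by move=> X /(extreme_mccann t01 GG LG B_psd S_psd SS rank_B) [].
Qed.
End Hull.

(** * Block coordinates *)

Lemma gram_ker_sub (R : realType) (m p q k : nat) (X : 'M[R]_(m, k))
    (Y : 'M[R]_(p, k)) (N : 'M[R]_(k, q)) :
  X^T *m X = Y^T *m Y -> X *m N = 0 -> Y *m N = 0.
Proof.
move=> XY XN; apply: gramT_eq0.
by rewrite trmx_mul -mulmxA (mulmxA Y^T) -XY -mulmxA XN !mulmx0.
Qed.

(** [S P] is the orthogonal projection onto the range of [S], which contains the range of [Z Z^T],
    that is, of [Z]. *)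
Lemma penrose_gram (R : realType) (r n : nat) (S P : 'M[R]_r)
    (Z : 'M[R]_(r, n)) :
  penrose S P -> S *m S = Z *m Z^T -> S *m P *m Z = Z.
Proof.
case=> P1 _ _ _ SZ; apply/eqP; rewrite -subr_eq0; apply/eqP/gram_eq0.
have -> : S *m P *m Z - Z = (S *m P - 1%:M) *m Z by rewrite mulmxBl mul1mx.
rewrite trmx_mul mulmxA -(mulmxA _ Z Z^T) -SZ.
by rewrite mulmxA mulmxBl mul1mx P1 subrr !mul0mx.
Qed.

(* Z^T (Z Z^T)^+ Z and K^T (K K^T)^+ K are the orthogonal projections onto the
   same row space. *)
Lemma gram_projection (R : realType) (r n : nat) (Q P : 'M[R]_r)
    (K : 'M[R]_(r, n)) (S : 'M[R]_r) :
  Q \in unitmx -> S^T = S -> S *m S = Q *m K *m (Q *m K)^T -> penrose S P ->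
  K^T *m pinvmp (K *m K^T) *m K = (Q *m K)^T *m P *m P *m (Q *m K).
Proof.
move=> uQ S_sym SZ SP; have [P_sym comm] := penrose_sym S_sym SP.
have [P1 P2 _ _] := SP; set Z := Q *m K in SZ *.
have ZE : Z = Q *m K by [].
have KE : K = invmx Q *m Z by rewrite mulKmx.
clearbody Z.
pose X := pinvmp (K *m K^T); have KKX := pinvmpP (K *m K^T).
have KK_sym : (K *m K^T)^T = K *m K^T by rewrite trmx_mul trmxK.
have [X_sym _] := penrose_sym KK_sym KKX.
case: KKX; rewrite -/X in X_sym * => X1 _ _ _.
have E2K : K *m (K^T *m X *m K) = K.
  apply/eqP; rewrite -subr_eq0; apply/eqP/gram_eq0.
  have -> : K *m (K^T *m X *m K) - K = (K *m K^T *m X - 1%:M) *m K.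
    by rewrite mulmxBl mul1mx !mulmxA.
  rewrite trmx_mul mulmxA -(mulmxA _ K K^T) mulmxBl mul1mx X1 subrr.
  by rewrite mul0mx.
have PZ : S *m P *m Z = Z by exact: penrose_gram SP SZ.
have E1Z : Z *m (Z^T *m P *m P *m Z) = Z.
  by rewrite !mulmxA -SZ -(mulmxA S S P) comm mulmxA P1 PZ.
(* Each projection absorbs the other; transposing one of the two identities gives equality. *)
have E12 : K^T *m X *m K *m (Z^T *m P *m P *m Z) = K^T *m X *m K.
  by rewrite -(mulmxA _ K) {2}KE -(mulmxA _ Z) E1Z -KE.
have E21 : Z^T *m P *m P *m Z *m (K^T *m X *m K) = Z^T *m P *m P *m Z.
  by rewrite -(mulmxA _ Z) {2}ZE -(mulmxA Q) E2K -ZE.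
have E1_sym : (Z^T *m P *m P *m Z)^T = Z^T *m P *m P *m Z.
  by rewrite !trmx_mul trmxK P_sym !mulmxA.
have E2_sym : (K^T *m X *m K)^T = K^T *m X *m K.
  by rewrite !trmx_mul trmxK X_sym !mulmxA.
by rewrite -E2_sym -E12 trmx_mul E1_sym E2_sym E21.
Qed.

Section Blocks.
Variables (R : realType) (n r s : nat) (A : 'M[R]_n).
Variables (U1 : 'M[R]_(n, r)) (U2 : 'M[R]_(n, s)).
Hypothesis A_psd : psdmx A.
Hypothesis bases : range_null_bases A U1 U2.

Let A_sym : A^T = A. Proof. by case: A_psd. Qed.

Lemma rank_range : \rank A = r.
Proof.
have [U11 _ rA _] := bases; rewrite -mxrank_tr -rA.
by apply/eqP; apply/row_freeP; exists U1.
Qed.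

Lemma null_base : A *m U2 = 0.
Proof.
have [_ _ _ kA] := bases; rewrite -[LHS]trmxK trmx_mul.
by have /sub_kermxP -> : (U2^T <= kermx A^T)%MS; rewrite ?kA ?trmx0.
Qed.

Lemma bases_ortho : U1^T *m U2 = 0.
Proof.
have [_ _ rA _] := bases; have /submxP [X ->] : (U1^T <= A)%MS.
  by rewrite -A_sym rA.
by rewrite -mulmxA null_base mulmx0.
Qed.

Let ortho21 : U2^T *m U1 = 0.
Proof. by rewrite -[LHS]trmxK trmx_mul trmxK bases_ortho trmx0. Qed.

Let U11 : U1^T *m U1 = 1%:M. Proof. by case: bases. Qed.
Let U22 : U2^T *m U2 = 1%:M. Proof. by case: bases. Qed.

(** A dimension count gives [r + s = n], so the orthonormal columns of [U] form a basis. As [r + s]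
    and [n] are not convertible, a right inverse [V] stands in for squareness. *)
Lemma bases_resolution : U1 *m U1^T + U2 *m U2^T = 1%:M.
Proof.
have [_ _ rA kA] := bases.
have rs : (r + s)%N = n.
  have s_rank : \rank U2^T = s by apply/eqP/row_freeP; exists U2.
  rewrite -s_rank kA mxrank_ker mxrank_tr rank_range subnKC //.
  by rewrite -rank_range rank_leq_col.
pose U := row_mx U1 U2.
have UU : U^T *m U = 1%:M.
  rewrite tr_row_mx mul_col_row U11 U22 bases_ortho ortho21.
  by rewrite -scalar_mx_block.
have /eqP rU : row_full U by apply/row_fullP; exists U^T.
have /row_freeP [V UV] : row_free U by rewrite /row_free rU rs.
have <- : U *m U^T = U1 *m U1^T + U2 *m U2^T by rewrite tr_row_mx mul_row_col.
by rewrite -[X in X *m U^T]mulmx1 -[U^T]mulmx1 -UV (mulmxA U^T) UU mul1mx mulmx1.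
Qed.

Lemma mx_resolution (p : nat) (W : 'M[R]_(n, p)) :
  W = U1 *m (U1^T *m W) + U2 *m (U2^T *m W).
Proof. by rewrite !mulmxA -mulmxDl bases_resolution mul1mx. Qed.

Lemma range_compression : A = U1 *m blk U1 U1 A *m U1^T.
Proof.
have AU : A *m U1 *m U1^T = A.
  rewrite -[RHS]mulmx1 -bases_resolution mulmxDr !mulmxA null_base mul0mx addr0.
  by [].
have UA : U1 *m U1^T *m A = A.
  by rewrite -[RHS]A_sym -{2}AU !trmx_mul trmxK A_sym !mulmxA.
by rewrite /blk !mulmxA UA AU.
Qed.

(** * Optimal factors and barycenters in block form *)

Section Factor.
Variables (B : 'M[R]_n) (t : R) (G11 : 'M[R]_r).
Hypothesis B_psd : psdmx B.
Hypothesis t01 : 0 < t < 1.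
Hypothesis GG11 : G11 *m G11^T = blk U1 U1 A.

(** A factor of [A] with left inverse [invmx G11 *m U1^T], so the description of barycenters by [W]
    applies to it. *)
Let G := U1 *m G11.
Let S := sqrtmx (G11^T *m blk U1 U1 B *m G11).
Let P := pinvmp S.

Lemma range_factorE : G *m G^T = A.
Proof. by rewrite trmx_mul mulmxA -(mulmxA U1) GG11 -range_compression. Qed.

Let uG : G11 \in unitmx.
Proof.
rewrite -row_free_unit /row_free eqn_leq rank_leq_row -{1}rank_range.
rewrite -range_factorE -mulmxA (leq_trans (mxrankM_maxr _ _)) //.
by rewrite mxrankM_maxl.
Qed.

Let uGT : G11^T \in unitmx. Proof. by rewrite unitmx_tr. Qed.

Lemma range_factor_inv : invmx G11 *m U1^T *m G = 1%:M.
Proof. by rewrite mulmxA -(mulmxA _ U1^T) U11 mulmx1 mulVmx. Qed.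

Let S_psd : psdmx S /\ S *m S = G11^T *m blk U1 U1 B *m G11.
Proof. exact/sqrtmxP/psd_conjT/psd_conjT. Qed.

Let S_sym : S^T = S. Proof. by case: S_psd => -[]. Qed.

Lemma range_factor_sqrt : S *m S = G^T *m B *m G.
Proof. by rewrite (proj2 S_psd) /blk trmx_mul !mulmxA. Qed.

Let SP : penrose S P. Proof. exact: pinvmpP. Qed.

(** The first block column of [bary_M], carried back to the standard coordinates. *)
Definition factor_of (N : 'M[R]_(r, s)) : 'M[R]_(n, r) :=
  U1 *m (invmx G11^T *m S) + U2 *m (blk U2 U1 B *m G11 *m P + N^T).

Lemma factor_of1 N : U1^T *m factor_of N = invmx G11^T *m S.
Proof.
by rewrite mulmxDr !(mulmxA U1^T) U11 bases_ortho mul1mx mul0mx addr0.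
Qed.

Lemma factor_of2 N : U2^T *m factor_of N = blk U2 U1 B *m G11 *m P + N^T.
Proof.
by rewrite mulmxDr !(mulmxA U2^T) U22 ortho21 mul1mx mul0mx add0r.
Qed.

Lemma factor_of_range N : G^T *m factor_of N = S.
Proof. by rewrite trmx_mul -mulmxA factor_of1 mulKVmx. Qed.

(** Write [B = K K^T] with blocks [K1], [K2]. The relation [S^2 = Z Z^T] for [Z = G11^T K1] and
    [S N = 0] clear the blocks touching H1; on H2, [P N = 0] kills the cross terms and
    [gram_projection] turns [K1^T B11^+ K1] into [Z^T P P Z]. *)
Lemma factor_of_gap (N : 'M[R]_(r, s)) : S *m N = 0 ->
  B - factor_of N *m (factor_of N)^T =
  U2 *m (schur U1 U2 B - N^T *m N) *m U2^T.
Proof.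
move=> SN; set W := factor_of N.
have [K BE] := psd_factor B_psd; have [P_sym comm] := penrose_sym S_sym SP.
have [P1 P2 _ _] := SP.
pose K1 := U1^T *m K; pose K2 := U2^T *m K.
have B11 : blk U1 U1 B = K1 *m K1^T by rewrite /blk BE trmx_mul trmxK !mulmxA.
have B12 : blk U1 U2 B = K1 *m K2^T by rewrite /blk BE trmx_mul trmxK !mulmxA.
have B21 : blk U2 U1 B = K2 *m K1^T by rewrite /blk BE trmx_mul trmxK !mulmxA.
have B22 : blk U2 U2 B = K2 *m K2^T by rewrite /blk BE trmx_mul trmxK !mulmxA.
clearbody K1 K2; have [Z ZE] : exists Z, Z = G11^T *m K1 by exists (G11^T *m K1).
have SZ : S *m S = Z *m Z^T.
  by rewrite (proj2 S_psd) B11 ZE trmx_mul trmxK !mulmxA.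
have PN : P *m N = 0.
  by rewrite -P2 -(mulmxA P S P) comm -!mulmxA SN !mulmx0.
have NP : N^T *m P = 0 by rewrite -P_sym -trmx_mul PN trmx0.
have PZ : S *m P *m Z = Z by exact: penrose_gram SP SZ.
have W1 : U1^T *m W = invmx G11^T *m S by exact: factor_of1.
have W2 : U2^T *m W = K2 *m Z^T *m P + N^T.
  by rewrite factor_of2 B21 ZE trmx_mul trmxK !mulmxA.
have W2T : (U2^T *m W)^T = P *m Z *m K2^T + N.
  by rewrite W2 linearD /= !trmx_mul !trmxK P_sym !mulmxA.
have GB : invmx G11^T *m Z = K1 by rewrite ZE mulKmx.
pose D := B - W *m W^T.
have blkD (p q : nat) (V1 : 'M[R]_(n, p)) (V2 : 'M[R]_(n, q)) :
    V1^T *m D *m V2 = blk V1 V2 B - V1^T *m W *m (V2^T *m W)^T.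
  by rewrite mulmxBr mulmxBl trmx_mul trmxK !mulmxA.
have D11 : U1^T *m D *m U1 = 0.
  rewrite blkD W1 B11 trmx_mul S_sym mulmxA -(mulmxA _ S S) SZ mulmxA GB.
  by rewrite -mulmxA -trmx_mul GB subrr.
have D12 : U1^T *m D *m U2 = 0.
  rewrite blkD W1 W2T B12 mulmxDr -(mulmxA _ S N) SN mulmx0 addr0.
  by rewrite -(mulmxA (invmx _) S) !(mulmxA S) PZ mulmxA GB subrr.
have D_sym : D^T = D.
  by rewrite linearB /= trmx_mul trmxK (proj1 B_psd).
have D21 : U2^T *m D *m U1 = 0.
  by apply: trmx_inj; rewrite !trmx_mul trmxK D_sym mulmxA D12 trmx0.
have D22 : U2^T *m D *m U2 = schur U1 U2 B - N^T *m N.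
  rewrite blkD W2T W2 mulmxDl !mulmxDr -!(mulmxA (K2 *m Z^T)) PN mulmx0 addr0.
  rewrite !(mulmxA N^T) NP !mul0mx add0r opprD addrA; congr (_ - _).
  rewrite B22 /schur B22 B21 B12 B11; congr (_ - _).
  have := SZ; rewrite {1 2}ZE => /(gram_projection uGT S_sym)/(_ SP).
  rewrite -ZE => projE.
  rewrite -!mulmxA (mulmxA (pinvmp _)) (mulmxA K1^T) (mulmxA K1^T) projE.
  by rewrite !mulmxA.
rewrite -/D [LHS](mx_resolution D).
rewrite -[U1^T *m D]mulmx1 -[U2^T *m D]mulmx1 -bases_resolution.
rewrite !(mulmxDr (_ *m D)) !(mulmxA _ _ (_^T)) D11 D12 D21 D22.
by rewrite !mul0mx addr0 mulmx0 !add0r mulmxA.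
Qed.

(** [G^T W = S] fixes the H1 part of [W]; [N] is the freedom left in the H2 part. *)
Lemma opt_factor_blocks W :
  opt_factor B G S W <-> exists N : 'M[R]_(r, s),
    [/\ S *m N = 0, psdmx (schur U1 U2 B - N^T *m N) & W = factor_of N].
Proof.
split=> [W_opt|[N [SN D_psd ->]]]; last first.
  by split; [exact: factor_of_range|rewrite factor_of_gap //; exact: psd_conj].
have [WS W_psd] := W_opt; have [P1 _ _ _] := SP.
have W1 : U1^T *m W = invmx G11^T *m S by rewrite -WS trmx_mul -mulmxA mulKmx.
pose N := (U2^T *m W - blk U2 U1 B *m G11 *m P)^T.
have WE : W = factor_of N.
  rewrite [LHS]mx_resolution W1 /factor_of trmxK; congr (_ + _ *m _).
  by rewrite addrC subrK.
(* [gap_kernel] gives [B G = W S], and then [S P S = S] makes [N^T S] cancel. *)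
have SN : S *m N = 0.
  have := gap_kernel (proj1 S_psd) range_factor_sqrt W_opt.
  move=> /(congr1 trmx); rewrite trmx_mul trmxK trmx0 (proj1 W_psd) mulmxBl.
  rewrite -mulmxA => /eqP; rewrite subr_eq0 => /eqP BG.
  have WG : W^T *m G = S by rewrite -S_sym -WS trmx_mul trmxK.
  rewrite -[LHS]trmxK trmx_mul trmxK S_sym mulmxBl /blk.
  rewrite -(mulmxA _ U1 G11) -(mulmxA U2^T B) BG WG -!mulmxA (mulmxA S) P1.
  by rewrite subrr trmx0.
exists N; split=> //.
have := psd_conjT U2 W_psd; rewrite {1 2}WE factor_of_gap // !mulmxA U22.
by rewrite mul1mx -mulmxA U22 mulmx1.
Qed.

(** [B11^(1/2) G11] and [S] have the same Gram matrix, hence the same kernel. *)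
Lemma bary_paramP (N : 'M[R]_(r, s)) (M22 : 'M[R]_s) :
  bary_param U1 U2 B G11 N M22 <->
  [/\ S *m N = 0, psdmx (schur U1 U2 B - N^T *m N) &
      M22 *m M22^T = schur U1 U2 B - N^T *m N].
Proof.
have [[Q_sym _] QQ] := sqrtmxP (psd_conjT U1 B_psd : psdmx (blk U1 U1 B)).
set Q := sqrtmx _ in Q_sym QQ.
have QS : (Q *m G11)^T *m (Q *m G11) = S^T *m S.
  by rewrite S_sym (proj2 S_psd) trmx_mul Q_sym mulmxA -(mulmxA _ Q Q) QQ.
split=> [[kerN D_psd M22E]|[SN D_psd M22E]]; split=> //.
  apply: (gram_ker_sub QS); move/sub_kermxP: kerN => /(congr1 trmx).
  by rewrite trmx_mul !trmxK trmx0.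
by apply/sub_kermxP; rewrite -trmx_mul (gram_ker_sub (esym QS) SN) trmx0.
Qed.

Lemma bary_GamE (N : 'M[R]_(r, s)) (M22 : 'M[R]_s) :
  bary_Gam U1 U2 t B G11 N M22 =
  ((1 - t) *: G + t *: factor_of N) *m ((1 - t) *: G + t *: factor_of N)^T +
  t ^+ 2 *: (U2 *m (M22 *m M22^T) *m U2^T).
Proof.
rewrite /bary_Gam mulmxA -mulmxA -trmx_mul /bary_Gt /bary_G /bary_M.
rewrite !scale_block_mx add_block_mx !scaler0 !addr0 !add0r mul_row_block.
rewrite mulmx0 add0r.
have -> : U1 *m ((1 - t) *: G11 + t *: (invmx G11^T *m S)) +
    U2 *m (t *: (blk U2 U1 B *m G11 *m P + N^T)) =
    (1 - t) *: G + t *: factor_of N.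
  by rewrite mulmxDr -!scalemxAr -addrA -scalerDr.
rewrite tr_row_mx mul_row_col; congr (_ + _).
rewrite -scalemxAr [(t *: _)^T]linearZ /= -scalemxAl -scalemxAr scalerA -expr2.
by rewrite trmx_mul !mulmxA.
Qed.

(** The [M22] column contributes exactly [t^2] times the gap [B - W W^T], whence the independence of
    the choice of [M22]. *)
Lemma bary_Gam_interp (N : 'M[R]_(r, s)) (M22 : 'M[R]_s) :
  bary_param U1 U2 B G11 N M22 ->
  bary_Gam U1 U2 t B G11 N M22 = interp A B t G (factor_of N).
Proof.
move=> /bary_paramP [SN _ M22E].
rewrite bary_GamE M22E -factor_of_gap // mix_gram range_factorE /interp.
move: (_ *m _) (_ *m _) (_ *m _) => X1 X2 X3.
by apply/matrixP => i j; rewrite !mxE; ring.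
Qed.

Lemma barycenters_blocks :
  barycenters t A B =
  [set Gam | exists (N12 : 'M[R]_(r, s)) (M22 : 'M[R]_s),
     bary_param U1 U2 B G11 N12 M22 /\
     Gam = bary_Gam U1 U2 t B G11 N12 M22].
Proof.
have bary := barycenters_opt t01 range_factorE B_psd (proj1 S_psd)
  range_factor_sqrt.
apply/seteqP; split=> Gam.
  move=> /bary [W /opt_factor_blocks [N [SN D_psd ->]] ->].
  have [M22 M22E] := psd_factor D_psd; exists N, M22.
  have NP : bary_param U1 U2 B G11 N M22 by apply/bary_paramP.
  by rewrite bary_Gam_interp.
move=> [N [M22 [NP ->]]]; apply/bary; exists (factor_of N).
  by apply/opt_factor_blocks; exists N; have /bary_paramP [] := NP.
exact: bary_Gam_interp.
Qed.

(** [Gam = H H^T + U2 D U2^T] with the H1 part of [H] invertible: the Schur complement of [H H^T] is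
    then zero, leaving [D], and [Gam] has the rank of [diag(1, D)]. *)
Lemma bary_Gam_schur (N : 'M[R]_(r, s)) (M22 : 'M[R]_s) :
  bary_param U1 U2 B G11 N M22 ->
  let Gam := bary_Gam U1 U2 t B G11 N M22 in
  schur U1 U2 Gam = t ^+ 2 *: (schur U1 U2 B - N^T *m N) /\
  \rank Gam = (\rank A + \rank (schur U1 U2 Gam))%N.
Proof.
move=> /bary_paramP [SN D_psd M22E] Gam.
have /andP [t_gt0 t_lt1] := t01.
pose D := t ^+ 2 *: (schur U1 U2 B - N^T *m N).
pose H := (1 - t) *: G + t *: factor_of N.
have GamE : Gam = H *m H^T + U2 *m D *m U2^T.
  by rewrite /Gam bary_GamE M22E /D -scalemxAr -scalemxAl.
pose H1 := U1^T *m H; pose H2 := U2^T *m H.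
have uH1 : H1 \in unitmx.
  (* [G11^T H1 = (1 - t) G11^T G11 + t S] is positive definite since [t < 1]. *)
  have : G11^T *m H1 \in unitmx.
    rewrite -row_free_unit; apply/inj_row_free => v vH.
    have quad : (1 - t) *: ((v *m G11^T) *m (v *m G11^T)^T) +
        t *: (v *m S *m v^T) = 0.
      rewrite -[RHS](mul0mx _ v^T) -vH /H1 mulmxA -trmx_mul -/G mulmxDr -!scalemxAr.
      rewrite factor_of_range mulmxDr mulmxDl -!scalemxAr -!scalemxAl.
      by rewrite {2}/G !trmx_mul trmxK !mulmxA -(mulmxA _ U1^T U1) U11 mulmx1.
    have tr0 := congr1 mxtrace quad; rewrite linearD !linearZ /= linear0 in tr0.
    have S_ge := psd_tr_ge0 (psd_conj v (proj1 S_psd)).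
    have G_ge := gram_tr_ge0 (v *m G11^T).
    have tS_ge : 0 <= t * \tr (v *m S *m v^T) by rewrite mulr_ge0 // ltW.
    have : (1 - t) * \tr (v *m G11^T *m (v *m G11^T)^T) = 0.
      apply/le_anti; rewrite mulr_ge0 ?subr_ge0 ?(ltW t_lt1) // andbT; lra.
    move/eqP; rewrite mulf_eq0 subr_eq0 (gt_eqF t_lt1) /= => /eqP/gram_tr_eq0 vG.
    by rewrite -[v](mulmxK uGT) vG mul0mx.
  by rewrite unitmx_mul => /andP [].
have ortho11 : U1^T *m (U2 *m D *m U2^T) = 0.
  by rewrite !mulmxA bases_ortho !mul0mx.
have G11E : blk U1 U1 Gam = H1 *m H1^T.
  by rewrite /blk GamE mulmxDr ortho11 addr0 trmx_mul trmxK !mulmxA.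
have G12E : blk U1 U2 Gam = H1 *m H2^T.
  by rewrite /blk GamE mulmxDr ortho11 addr0 trmx_mul trmxK !mulmxA.
have G21E : blk U2 U1 Gam = H2 *m H1^T.
  rewrite /blk GamE mulmxDr mulmxDl !mulmxA -(mulmxA _ U2^T U1) ortho21.
  by rewrite mulmx0 addr0 trmx_mul trmxK !mulmxA.
have G22E : blk U2 U2 Gam = H2 *m H2^T + D.
  rewrite /blk GamE mulmxDr mulmxDl trmx_mul trmxK !mulmxA U22 mul1mx.
  by rewrite -(mulmxA D) U22 mulmx1.
have schurE : schur U1 U2 Gam = D.
  have uH1T : H1^T \in unitmx by rewrite unitmx_tr.
  rewrite /schur G11E G12E G21E G22E.
  have [X1 _ _ _] := pinvmpP (H1 *m H1^T); set X := pinvmp _ in X1 *.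
  have H1X : H1^T *m X *m H1 = 1%:M.
    rewrite -[LHS](mulKmx uH1) -[H1 *m _](mulmxK uH1T).
    have -> : H1 *m (H1^T *m X *m H1) *m H1^T = H1 *m H1^T.
      by rewrite -[RHS]X1 !mulmxA.
    by rewrite mulmxK // mulVmx.
  have -> : H2 *m H1^T *m X *m (H1 *m H2^T) =
      H2 *m (H1^T *m X *m H1) *m H2^T by rewrite !mulmxA.
  by rewrite H1X mulmx1 addrC addKr.
split; first by [].
rewrite schurE rank_range.
pose Q : 'M[R]_(n, r + s) := row_mx H U2.
pose E : 'M[R]_(r + s) := block_mx 1%:M 0 0 D.
have QE : Gam = Q *m E *m Q^T.
  rewrite GamE /Q /E mul_row_block !mulmx0 addr0 add0r mulmx1.
  by rewrite tr_row_mx mul_row_col.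
(* The transposed basis turns [Q] into an invertible block triangular matrix, so [Q] has a left
   inverse and [E] is recovered from [Gam]. *)
have [V VQ] : exists V : 'M[R]_(r + s, n), V *m Q = 1%:M.
  have uX : block_mx H1 0 H2 1%:M \in @unitmx R (r + s).
    by rewrite unitmxE det_lblock det1 mulr1 -unitmxE.
  exists (invmx (block_mx H1 0 H2 1%:M) *m (row_mx U1 U2)^T).
  rewrite -mulmxA tr_row_mx mul_col_row bases_ortho U22.
  exact: mulVmx.
have <- : \rank E = (r + \rank D)%N by rewrite rank_diag_block_mx mxrank1.
apply/eqP; rewrite eqn_leq; apply/andP; split.
  by rewrite QE (leq_trans (mxrankM_maxl _ _)) // mxrankM_maxr.
have -> : E = V *m Gam *m V^T.
  by rewrite QE !mulmxA VQ mul1mx -mulmxA -trmx_mul VQ trmx1 mulmx1.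
by rewrite (leq_trans (mxrankM_maxl _ _)) // mxrankM_maxr.
Qed.

(** Injectivity of [interp] identifies the McCann factor with [factor_of N], whose gap is given by
    [factor_of_gap]. *)
Lemma mccann_blocks (N : 'M[R]_(r, s)) (M22 : 'M[R]_s) :
  bary_param U1 U2 B G11 N M22 ->
  mccann t A B (bary_Gam U1 U2 t B G11 N M22) <->
  schur U1 U2 B - N^T *m N = 0.
Proof.
move=> NP; rewrite bary_Gam_interp //; have /bary_paramP [SN D_psd _] := NP.
have opt : opt_factor B G S (factor_of N).
  by apply/opt_factor_blocks; exists N.
have mcc := mccann_opt t range_factorE range_factor_inv B_psd (proj1 S_psd)
  range_factor_sqrt.
have gapE := factor_of_gap SN.
split=> [/mcc [W W_opt [WW]]|D0].
  move/(interp_inj t01 range_factor_inv opt W_opt) => WE.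
  move: gapE; rewrite WE WW subrr => /(congr1 (fun X => U2^T *m X *m U2)).
  rewrite mulmx0 mul0mx !mulmxA U22 mul1mx -mulmxA U22 mulmx1.
  by move=> <-.
apply/mcc; exists (factor_of N) => //; split=> //.
by apply/eqP; rewrite eq_sym -subr_eq0 gapE D0 mulmx0 mul0mx.
Qed.

End Factor.
End Blocks.

(** * Extreme points, closed convex hull and rank criteria *)

Theorem theorem4p8 (R : realType) (n : nat) (A B : 'M[R]_n) (t : R)
    (A_psd : psdmx A) (B_psd : psdmx B) (rank_AB : (\rank B <= \rank A)%N)
    (t01 : 0 < t < 1) :
  (forall Gam : 'M[R]_n,
     extreme_point (barycenters t A B) Gam <-> mccann t A B Gam) /\
  barycenters t A B = closed_convex_hull (mccann t A B) /\
  (forall (r s : nat) (U1 : 'M[R]_(n, r)) (U2 : 'M[R]_(n, s)),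
     range_null_bases A U1 U2 ->
     (forall G11 : 'M[R]_r, G11 *m G11^T = blk U1 U1 A ->
        barycenters t A B =
          [set Gam | exists (N12 : 'M[R]_(r, s)) (M22 : 'M[R]_s),
             bary_param U1 U2 B G11 N12 M22 /\
             Gam = bary_Gam U1 U2 t B G11 N12 M22] /\
        forall (N12 : 'M[R]_(r, s)) (M22 : 'M[R]_s),
          bary_param U1 U2 B G11 N12 M22 ->
          let Gam := bary_Gam U1 U2 t B G11 N12 M22 in
          schur U1 U2 Gam = t ^+ 2 *: (schur U1 U2 B - N12^T *m N12) /\
          \rank Gam = (\rank A + \rank (schur U1 U2 Gam))%N) /\
     (forall Gam : 'M[R]_n, barycenters t A B Gam ->
        [<-> mccann t A B Gam;
             schur U1 U2 Gam = 0;
             \rank Gam = \rank A])).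
Proof.
(* With exactly [\rank A] columns, [G] has a left inverse and [rank_AB] bounds [\rank B] by the
   number of columns. *)
have [G GG] := psd_rank_factor A_psd (leqnn _).
have [L LG] : exists L, L *m G = 1%:M by apply: left_inverse_factor; rewrite GG.
have [S_psd SS] := sqrtmxP (psd_conjT G B_psd).
split; [|split].
- exact: extreme_mccann t01 GG LG B_psd S_psd SS rank_AB.
- exact: barycenters_hull t01 GG LG B_psd S_psd SS rank_AB.
move=> r s U1 U2 bases; split=> [G11 GG11|Gam Gam_bary].
  split; first exact: barycenters_blocks.
  by move=> N12 M22; exact: bary_Gam_schur.
(* The equivalences do not mention [G11], so any factor of [A11] may serve. *)
have [G11 /esym GG11] := psd_factor (psd_conjT U1 A_psd).
move: Gam_bary; rewrite (barycenters_blocks A_psd bases B_psd t01 GG11).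
case=> N [M22 [NP ->]].
have [schurE rankE] := bary_Gam_schur A_psd bases B_psd t01 GG11 NP.
have mcc := mccann_blocks A_psd bases B_psd t01 GG11 NP.
have t2 : t ^+ 2 != 0 by case/andP: t01 => t0 _; rewrite expf_neq0 // gt_eqF.
tfae.
- by rewrite schurE => /mcc ->; rewrite scaler0.
- by move=> schur0; rewrite rankE schur0 mxrank0 addn0.
- move=> /eqP; rewrite rankE -[X in _ == X]addn0 eqn_add2l mxrank_eq0 schurE.
  by rewrite scaler_eq0 (negPf t2) => /eqP/mcc.
Qed.
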